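(* For every fixed integer $d\geq 1$, as $n\to\infty$ through even integers, \[ \mathbb{E}\operatorname{MaxCut}(\widehat G_{n,d})-\mathbb{E}\operatorname{MaxBis}(\widehat G_{n,d})=o(n). \] Moreover, there is a constant $b_d$ such that, in the same limit, \[ \frac1n\mathbb{E}\operatorname{MaxCut}(\widehat G_{n,d})\longrightarrow b_d,\qquad \frac1n\mathbb{E}\operatorname{MaxBis}(\widehat G_{n,d})\longrightarrow b_d . \]
   Context: For a finite undirected multigraph $G$ on $V$ (loops and multiple edges allowed) and $S\subseteq V$, $\operatorname{cut}_G(S)$ is the number of edges with exactly one endpoint in $S$ (multiple edges counted with multiplicity; loops contribute nothing). Define \[ \operatorname{MaxCut}(G)=\max_{S\subseteq V}\operatorname{cut}_G(S),\qquad \operatorname{MaxBis}(G)=\max_{S\subseteq V,\ |S|=\lfloor |V|/2\rfloor}\operatorname{cut}_G(S). \] For even $n$, $\widehat G_{n,d}$ denotes the $d$-regular configuration model on $[n]=\{1,\dots,n\}$: attach $d$ labeled half-edges to each vertex, choose a uniformly random perfect matching of all $dn$ half-edges, and let each matched pair of half-edges give an edge between the two vertices to which they are attached (a loop if these coincide). The constant $b_d$ is the limit of $\frac1n\mathbb{E}\operatorname{MaxBis}(\widehat G_{n,d})$ along even $n$. *)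

(* Defs.v *)
From HB Require Import structures.
From mathcomp Require Import all_boot all_order all_algebra.
From mathcomp Require Import all_classical all_reals all_analysis.

Set Implicit Arguments.
Unset Strict Implicit.
Unset Printing Implicit Defensive.

Import Order.TTheory GRing.Theory Num.Theory.
Import numFieldNormedType.Exports.

Local Open Scope ring_scope.

(* Each edge of the finite type [edge] carries its set of endpoints, which is
   a singleton exactly when the edge is a loop.  Parallel edges are distinct
   elements of [edge] with the same endpoints. *)
Record multigraph (V : finType) := Multigraph {
  edge : finType;
  ends : edge -> {set V};
  card_ends : forall e, (0 < #|ends e| <= 2)%N
}.

(* The first conjunct discards loops, whose two endpoints coincide. *)
Definition crosses (V : finType) (G : multigraph V) (S : {set V})
    (e : edge G) : bool :=
  (#|ends e| == 2%N) && (#|ends e :&: S| == 1%N).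

Definition cut_size (V : finType) (G : multigraph V) (S : {set V}) : nat :=
  #|[pred e : edge G | crosses S e]|.

Definition MaxCut (V : finType) (G : multigraph V) : nat :=
  (\max_(S : {set V}) cut_size G S)%N.

Definition MaxBis (V : finType) (G : multigraph V) : nat :=
  (\max_(S : {set V} | #|S| == #|V|./2) cut_size G S)%N.

Definition is_perfect_matching (H : finType) (M : {set {set H}}) : bool :=
  finset.partition M [set: H] && [forall e in M, #|e| == 2%N].

Definition perfect_matching (H : finType) : finType :=
  {M : {set {set H}} | is_perfect_matching M}.

Definition pairs (H : finType) (M : perfect_matching H) : {set {set H}} :=
  sval M.

(* The half-edge [(v, k)] is the one attached to [v] with label [k]. *)
Definition half_edge (n d : nat) : finType := ('I_n * 'I_d)%type.

Section ConfigurationModel.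
Variables n d : nat.

Definition config_ends (M : perfect_matching (half_edge n d))
    (e : {e : {set half_edge n d} | e \in pairs M}) : {set 'I_n} :=
  fst @: val e.

Lemma card_config_ends (M : perfect_matching (half_edge n d))
    (e : {e : {set half_edge n d} | e \in pairs M}) :
  (0 < #|config_ends e| <= 2)%N.
Proof.
case: e => e eM /=; rewrite /config_ends /=.
have /andP[_ /forallP/(_ e)] := svalP M.
rewrite -/(pairs M) eM /= => /eqP e2; apply/andP; split; last first.
  by rewrite (leq_trans (leq_imset_card _ _)) ?e2.
have /card_gt0P[h he] : (0 < #|e|)%N by rewrite e2.
by apply/card_gt0P; exists h.1; apply/imsetP; exists h.
Qed.

Definition config_graph (M : perfect_matching (half_edge n d)) :
    multigraph 'I_n :=
  Multigraph (@card_config_ends M).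

(* The expectation of [X] under the uniform measure on perfect matchings; its
   junk value is 0 when [n * d] is odd and there is no perfect matching. *)
Definition config_mean (R : realType) (X : multigraph 'I_n -> R) : R :=
  (\sum_(M : perfect_matching (half_edge n d)) X (config_graph M))
    / #|{: perfect_matching (half_edge n d)}|%:R.

End ConfigurationModel.

Definition EMaxCut (R : realType) (n d : nat) : R :=
  config_mean d (fun G : multigraph 'I_n => (MaxCut G)%:R).

Definition EMaxBis (R : realType) (n d : nat) : R :=
  config_mean d (fun G : multigraph 'I_n => (MaxBis G)%:R).

Local Open Scope classical_set_scope.

Definition even_infty : set_system nat :=
  within [set n | ~~ odd n] \oo.

#[global] Instance even_infty_filter : ProperFilter even_infty.
Proof.
split; last exact: within_filter.
move=> [N _ /(_ N.*2)] /=; rewrite -addnn leq_addr => /(_ isT).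
by rewrite addnn odd_double => /(_ isT).
Qed.

(* Main.v *)
(* The interpolation method of Bayati, Gamarnik and Tetali compares a uniform
   pairing of all the half-edges with independent pairings inside blocks of
   half-edges, for the maximum over an arbitrary family of cuts.  Adding an edge
   [xy] to a graph raises this maximum by one, unless [x] and [y] have the same
   profile, i.e. lie on the same side in every optimal cut, in which case the
   maximum does not change.  Having the same profile is a positive semidefinite
   kernel, so two half-edges of one random block have the same profile at least
   as often as two half-edges of independent random blocks.  Hence replacing the
   edges inside blocks by uniform edges, one at a time, does not decrease the
   expected maximum, up to an error that is bounded per block as long as a
   fraction [1 / q] of the half-edges is left unpaired.

   For the family of bisections of [N] vertices and [N / n] blocks of [n]
   vertices, flipping some of the optimal cuts of the blocks makes their union
   balanced up to [n] vertices.  Letting [N], then [n], then [q] tend to infinity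
   in the resulting inequality between [EMaxBis N] and [(N / n) EMaxCut n] shows
   that both normalized sequences converge to the upper limit of
   [EMaxCut n / n]. *)

Require Import Defs.
From HB Require Import structures.
From mathcomp Require Import all_boot all_order all_algebra all_fingroup.
From mathcomp Require Import zify ring lra.
From mathcomp Require Import reals.

Set Implicit Arguments.
Unset Strict Implicit.
Unset Printing Implicit Defensive.

Import Order.TTheory GRing.Theory Num.Theory.

Local Open Scope ring_scope.

(** * Pairings and averages over permutations *)

Section PairLists.

Definition flat (T : Type) (E : seq (T * T)) : seq T :=
  flatten [seq [:: p.1; p.2] | p <- E].

Fixpoint pairup (T : Type) (s : seq T) : seq (T * T) :=
  if s is x :: y :: s' then (x, y) :: pairup s' else [::].

Definition pmap (T1 T2 : Type) (g : T1 -> T2) (E : seq (T1 * T1)) :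
  seq (T2 * T2) := [seq (g p.1, g p.2) | p <- E].

Lemma flat_cat (T : Type) (E1 E2 : seq (T * T)) :
  flat (E1 ++ E2) = flat E1 ++ flat E2.
Proof. by rewrite /flat map_cat flatten_cat. Qed.

Lemma flat_pmap (T1 T2 : Type) (g : T1 -> T2) E :
  flat (pmap g E) = map g (flat E).
Proof. by elim: E => //= p E; rewrite /flat /= => ->. Qed.

Lemma flatK (T : Type) (E : seq (T * T)) : pairup (flat E) = E.
Proof. by elim: E => //= -[x y] E; rewrite /flat /= => ->. Qed.

Lemma pmap_pairup (T1 T2 : Type) (g : T1 -> T2) s :
  pmap g (pairup s) = pairup (map g s).
Proof.
have [n] := ubnP (size s); elim: n s => // n IHn [|x [|y s]] //= le_s.
by rewrite IHn // -ltnS ltnW.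
Qed.

Lemma size_flat (T : Type) (E : seq (T * T)) : size (flat E) = (size E).*2.
Proof. by elim: E => //= p E; rewrite /flat /= => ->. Qed.

Lemma size_pairup (T : Type) (s : seq T) : size (pairup s) = (size s)./2.
Proof.
have [n] := ubnP (size s); elim: n s => // n IHn [|x [|y s]] //= le_s.
by rewrite IHn // -ltnS ltnW.
Qed.

Lemma flat_pairup (T : Type) (s : seq T) :
  flat (pairup s) = take ((size s)./2).*2 s.
Proof.
have [n] := ubnP (size s); elim: n s => // n IHn [|x [|y s]] //= le_s.
by rewrite {1}/flat /= -/(flat _) IHn // -ltnS ltnW.
Qed.

Lemma flat_take (T : Type) n (E : seq (T * T)) :
  flat (take n E) = take n.*2 (flat E).
Proof. by elim: E n => [|p E IHE] [|n] //; rewrite doubleS /= {1}/flat /= -/(flat _) IHE. Qed.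

Lemma perm_flat (T : eqType) (E E' : seq (T * T)) :
  perm_eq E E' -> perm_eq (flat E) (flat E').
Proof. by move=> EE'; apply/perm_flatten/perm_map. Qed.

Lemma mem_flat (T : eqType) (E : seq (T * T)) p :
  p \in E -> (p.1 \in flat E) && (p.2 \in flat E).
Proof.
move=> pE; apply/andP; split; apply/flattenP;
  by exists [:: p.1; p.2]; rewrite ?map_f ?inE ?eqxx ?orbT.
Qed.

Lemma pmap_comp (T1 T2 T3 : Type) (g : T2 -> T3) (h : T1 -> T2) E :
  pmap g (pmap h E) = pmap (g \o h) E.
Proof. by rewrite /pmap -map_comp. Qed.

End PairLists.

(** * Averages over block-preserving permutations *)

Section BlockAverage.
Variables (R : realFieldType) (H : finType).

Definition block_perms (I : eqType) (b : H -> I) : {set {perm H}} :=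
  [set s : {perm H} | [forall x, b (s x) == b x]].

(** Randomness is encoded by moving fixed half-edges with a uniform permutation that preserves the
    blocks; distinct blocks are thus sampled independently. *)
Definition avg (I : eqType) (b : H -> I) (phi : {perm H} -> R) : R :=
  (\sum_(s in block_perms b) phi s) / #|block_perms b|%:R.

Variables (I : eqType) (b : H -> I).
Implicit Types (phi psi : {perm H} -> R) (s t : {perm H}).

Lemma block_permsP s : reflect (forall x, b (s x) = b x) (s \in block_perms b).
Proof. by rewrite inE; apply: (iffP forallP) => h x; apply/eqP/h. Qed.

Lemma block_perms1 : 1%g \in block_perms b.
Proof. by apply/block_permsP => x; rewrite perm1. Qed.

Lemma block_permsM s t : s \in block_perms b ->
  (s * t \in block_perms b)%g = (t \in block_perms b).
Proof.
move=> /block_permsP hs; apply/block_permsP/block_permsP => ht x.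
  by rewrite -{1}(permKV s x) -permM ht -hs permKV.
by rewrite permM ht hs.
Qed.

Lemma card_block_perms_gt0 : 0 < #|block_perms b|%:R :> R.
Proof. by rewrite ltr0n card_gt0; apply/set0Pn; exists 1%g; exact: block_perms1. Qed.

Lemma eq_avg phi psi : {in block_perms b, phi =1 psi} -> avg b phi = avg b psi.
Proof. by move=> e; rewrite /avg (eq_bigr psi). Qed.

Lemma le_avg phi psi :
  (forall s, s \in block_perms b -> phi s <= psi s) -> avg b phi <= avg b psi.
Proof. by move=> le; rewrite ler_pM2r ?invr_gt0 ?card_block_perms_gt0 ?ler_sum. Qed.

Lemma avg_const c : avg b (fun=> c) = c.
Proof.
by rewrite /avg sumr_const -[c *+ _]mulr_natr mulfK // gt_eqF ?card_block_perms_gt0.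
Qed.

Lemma avgD phi psi : avg b (fun s => phi s + psi s) = avg b phi + avg b psi.
Proof. by rewrite /avg big_split mulrDl. Qed.

Lemma avgZ c phi : avg b (fun s => c * phi s) = c * avg b phi.
Proof. by rewrite /avg -mulr_sumr mulrA. Qed.

Lemma avgB phi psi : avg b (fun s => phi s - psi s) = avg b phi - avg b psi.
Proof. by rewrite /avg sumrB mulrBl. Qed.

Lemma avg_sum (J : Type) (r : seq J) (P : pred J) (phi : J -> {perm H} -> R) :
  avg b (fun s => \sum_(j <- r | P j) phi j s) = \sum_(j <- r | P j) avg b (phi j).
Proof. by rewrite /avg exchange_big /= mulr_suml. Qed.

Lemma avg_mull t phi : t \in block_perms b ->
  avg b (fun s => phi (t * s)%g) = avg b phi.
Proof.
move=> ht; congr (_ / _); rewrite [RHS](reindex_inj (mulgI t)).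
by apply: eq_bigl => s; rewrite block_permsM.
Qed.

(** A permutation matching the prefixes is corrected by the transposition of [t x] and [y], which
    lie in one block and outside the prefix [s2], so the prefixes stay matched. *)
Lemma block_perms_trans (s1 s2 : seq H) :
  uniq s1 -> uniq s2 -> map b s1 = map b s2 ->
  exists2 t, t \in block_perms b & map t s1 = s2.
Proof.
elim/last_ind: s1 s2 => [|s1 x IHs] s2.
  by case: s2 => //; exists 1%g; rewrite ?block_perms1.
case/lastP: s2 => [|s2 y]; first by rewrite map_rcons => _ _ /(congr1 size); rewrite size_rcons.
rewrite !rcons_uniq !map_rcons => /andP[xs1 us1] /andP[ys2 us2] /rcons_inj[e1 e2].
have [t ht ts] := IHs _ us1 us2 e1.
have tx : t x \notin s2 by rewrite -ts (mem_map perm_inj).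
exists (t * tperm (t x) y)%g.
  rewrite block_permsM //; apply/block_permsP => z.
  move/block_permsP: ht => ht.
  by case: tpermP => [->|->|//]; rewrite ht // e2.
rewrite map_rcons permM tpermL; congr rcons; rewrite -ts; apply/eq_in_map => z zs1.
rewrite permM tpermD //; last first.
  by apply: contraNneq ys2 => ->; rewrite -ts map_f.
by apply: contraNneq tx => ->; rewrite -ts map_f.
Qed.

Lemma avg_labels (phi : seq H -> R) (s1 s2 : seq H) :
  uniq s1 -> uniq s2 -> map b s1 = map b s2 ->
  avg b (fun s => phi (map s s1)) = avg b (fun s => phi (map s s2)).
Proof.
move=> u1 u2 /(block_perms_trans u1 u2)[t ht <-].
rewrite -[in LHS](avg_mull _ ht); apply: eq_avg => s _.
by congr phi; rewrite -map_comp; apply: eq_map => x; rewrite /= permM.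
Qed.

End BlockAverage.

(** * Maximum over a family of cuts and the effect of one more pair *)

Section MaxCutOfPairs.
Variable H : finType.
Implicit Types (cut : {set H}) (p : H * H) (E : seq (H * H)).

Definition crossing cut p : bool := (p.1 \in cut) != (p.2 \in cut).

Definition max_cut (Sg : {set {set H}}) E : nat :=
  (\max_(cut in Sg) count (crossing cut) E)%N.

Definition optimal (Sg : {set {set H}}) E : {set {set H}} :=
  [set cut in Sg | count (crossing cut) E == max_cut Sg E].

Definition profile Sg E (x : H) : {set {set H}} :=
  [set cut in optimal Sg E | x \in cut].

Variable Sg : {set {set H}}.

Lemma max_cut_perm E E' : perm_eq E E' -> max_cut Sg E = max_cut Sg E'.
Proof. by move=> /seq.permP eqE; apply: eq_bigr => cut _; exact: eqE. Qed.

Lemma leq_max_cut cut E : cut \in Sg -> (count (crossing cut) E <= max_cut Sg E)%N.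
Proof. by move=> ?; rewrite /max_cut (bigD1 cut) //= leq_maxl. Qed.

Lemma max_cut_le E m :
  (forall cut, cut \in Sg -> (count (crossing cut) E <= m)%N) -> (max_cut Sg E <= m)%N.
Proof. by move=> h; apply/bigmax_leqP. Qed.

Lemma max_cut_cat E E' :
  (max_cut Sg E <= max_cut Sg (E ++ E') <= max_cut Sg E + size E')%N.
Proof.
apply/andP; split; apply: max_cut_le => cut hcut.
  by apply: leq_trans (leq_max_cut _ hcut); rewrite count_cat leq_addr.
by rewrite count_cat leq_add ?leq_max_cut ?count_size.
Qed.

Hypothesis Sg0 : Sg != set0.

Lemma max_cut_attained E :
  exists2 cut, cut \in Sg & count (crossing cut) E = max_cut Sg E.
Proof.
have [|c cS e] := @eq_bigmax_cond _ (mem Sg) (fun c => count (crossing c) E).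
  by apply/card_gt0P/set0Pn.
by exists c.
Qed.

(** With one more pair, a cut that is not optimal for [E] reaches at most the old maximum. So only
    an optimal cut can raise it, and one does exactly when it separates the two ends of [p]. *)
Lemma max_cut_cons p E :
  max_cut Sg (p :: E) =
    (max_cut Sg E + (profile Sg E p.1 != profile Sg E p.2))%N.
Proof.
have [c0 c0S c0E] := max_cut_attained E.
apply/eqP; rewrite eqn_leq; apply/andP; split.
  apply: max_cut_le => c cS /=; have := leq_max_cut E cS.
  case: (eqVneq (count (crossing c) E) (max_cut Sg E)) => [cE|ne le]; last first.
    have: (count (crossing c) E < max_cut Sg E)%N by rewrite ltn_neqAle ne le.
    by case: (crossing c p); lia.
  move=> _; rewrite cE addnC leq_add2l.
  case: eqP => [/setP /(_ c)|_]; last by case: (crossing c p).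
  by rewrite !inE cS cE eqxx /crossing /= => ->; rewrite eqxx.
case: eqP => [_|/eqP].
  by rewrite addn0 -c0E; apply: leq_trans (leq_max_cut _ c0S); rewrite /= leq_addl.
apply: contraNT; rewrite -ltnNge addn1 ltnS => lt.
apply/eqP/setP => c; rewrite !inE.
case: (boolP (c \in Sg)) => //= cS; case: eqP => //= cE.
have := leq_trans (leq_max_cut (p :: E) cS) lt.
by rewrite /= cE /crossing; case: (_ \in c) (_ \in c) => -[]//=; rewrite ltnn.
Qed.

End MaxCutOfPairs.

(** * Filling blocks with pairs *)

Section Fill.
Variables (H I : finType) (b : H -> I).
Implicit Types (u E : seq (H * H)) (c n : I -> nat) (i j : I).

Definition block i : {set H} := [set z | b z == i].

Definition free E i : {set H} := [set z in block i | z \notin flat E].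

Definition rest u i : seq H := enum (free u i).

(* Block [i] receives less than [c i] pairs if [u] leaves it too few half-edges. *)
Definition fill u c : seq (H * H) :=
  u ++ flatten [seq take (c i) (pairup (rest u i)) | i <- enum I].

Definition diag n : seq (I * I) := flatten [seq nseq (n i) (i, i) | i <- enum I].

Lemma count_flat (T : Type) (P : pred T) (E : seq (T * T)) :
  count P (flat E) = (count (fun p => P p.1) E + count (fun p => P p.2) E)%N.
Proof. by elim: E => //= p E; rewrite /flat /= => ->; lia. Qed.

Lemma count_diag (P : pred (I * I)) n :
  count P (diag n) = (\sum_i P (i, i) * n i)%N.
Proof.
rewrite count_flatten -map_comp sumnE big_map big_enum /=.
by apply: eq_bigr => i _; rewrite count_nseq.
Qed.

Lemma count_mem_diag i j n : count_mem (i, j) (diag n) = ((i == j) * n i)%N.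
Proof.
rewrite count_diag (bigD1 i) //= big1 ?addn0 => [|k ki].
  by rewrite xpair_eqE eqxx.
by rewrite xpair_eqE (negPf ki).
Qed.

Lemma count_flat_diag i n : count_mem i (flat (diag n)) = (n i).*2.
Proof.
rewrite count_flat !count_diag addnn; congr _.*2.
by rewrite (bigD1 i) //= big1 ?addn0 ?eqxx ?mul1n // => k /negPf->.
Qed.

Lemma perm_diag (s t : seq (I * I)) :
  (forall i j, count_mem (i, j) s = count_mem (i, j) t) -> perm_eq s t.
Proof. by move=> e; apply/allP => -[i j] _; apply/eqP/e. Qed.

Lemma card_free E i : uniq (flat E) ->
  (#|free E i| + count_mem i (flat (pmap b E)) = #|block i|)%N.
Proof.
move=> uE; rewrite -(cardsID [set z in flat E] (block i)) addnC; congr addn.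
  rewrite flat_pmap count_map -size_filter -(card_uniqP _) ?filter_uniq //.
  by apply: eq_card => z; rewrite mem_filter !inE.
by apply: eq_card => z; rewrite !inE andbC.
Qed.

Lemma pmap_rest u i k :
  pmap b (take k (pairup (rest u i))) = nseq (minn k #|free u i|./2) (i, i).
Proof.
have -> : pmap b (take k (pairup (rest u i))) = take k (pairup (map b (rest u i))).
  by rewrite -pmap_pairup /pmap map_take.
have -> : map b (rest u i) = nseq #|free u i| i.
  have /all_pred1P -> : all (pred1 i) (map b (rest u i)).
    by rewrite all_map; apply/allP => z; rewrite mem_enum !inE => /andP[].
  by rewrite size_map -cardE.
have -> l : pairup (nseq l i) = nseq l./2 (i, i).
  have [m] := ubnP l; elim: m l => // m IHm [|[|l]] //= lm.
  by rewrite IHm // -ltnS ltnW.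
have [le|/ltnW le] := leqP k #|free u i|./2.
  by rewrite take_nseq.
by rewrite take_oversize ?size_nseq.
Qed.

Lemma pmap_fill u c :
  pmap b (fill u c) = pmap b u ++ diag (fun i => minn (c i) #|free u i|./2).
Proof.
rewrite /pmap map_cat map_flatten -map_comp; congr (_ ++ flatten _).
by apply: eq_map => i /=; exact: pmap_rest.
Qed.

Lemma count_fill (T : Type) (g : H -> T) (Q : pred (T * T)) c :
  count Q (pmap g (fill [::] c)) =
  (\sum_i count Q (pmap g (take (c i) (pairup (rest [::] i)))))%N.
Proof.
rewrite /pmap /fill map_flatten -map_comp count_flatten -map_comp.
by rewrite sumnE big_map big_enum.
Qed.

Lemma uniq_fill u c : uniq (flat u) -> uniq (flat (fill u c)).
Proof.
move=> uu; apply: count_mem_uniq => z.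
suff: (count_mem z (flat (fill u c)) <= 1)%N.
  by rewrite -has_pred1 has_count; case: count => [|[]].
rewrite flat_cat count_cat.
have -> ss : flat (flatten ss) = flatten [seq flat E | E <- ss] :> seq H.
  by elim: ss => //= E ss IHss; rewrite flat_cat IHss.
rewrite [X in (_ + X)%N](_ : _ = \sum_(i : I)
    count_mem z (flat (take (c i) (pairup (rest u i)))))%N; last first.
  by rewrite -map_comp count_flatten -map_comp sumnE big_map big_enum.
rewrite (bigD1 (b z)) //= big1 ?addn0 => [|i iz]; last first.
  apply/count_memPn; rewrite flat_take flat_pairup.
  apply: contra iz => /mem_take/mem_take.
  by rewrite mem_enum !inE => /andP[/eqP-> _].
rewrite flat_take flat_pairup.
set t := take _ _.
have ut : uniq t by rewrite !take_uniq ?enum_uniq.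
rewrite !count_uniq_mem //; case: (boolP (z \in flat u)) => zu; last by case: (_ \in _).
suff /negPf-> : z \notin t by [].
by apply: contraL zu => /mem_take/mem_take; rewrite mem_enum !inE => /andP[].
Qed.

Lemma card_free_fill u c i : uniq (flat u) ->
  (#|free (fill u c) i| + (minn (c i) #|free u i|./2).*2 = #|free u i|)%N.
Proof.
move=> uu; have := card_free i (uniq_fill c uu); have := card_free i uu.
rewrite pmap_fill flat_cat count_cat count_flat_diag; lia.
Qed.

End Fill.

(** * Dependence on block types only *)

Section Types.
Variables (R : realFieldType) (H I : finType) (b : H -> I).

Lemma perm_map_lift (T1 T2 : eqType) (f : T1 -> T2) (s : seq T1) (t : seq T2) :
  perm_eq (map f s) t -> exists2 s', perm_eq s s' & map f s' = t.
Proof.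
case: s => [|x s]; first by rewrite perm_sym => /perm_nilP ->; exists [::].
rewrite perm_sym => /(perm_iotaP (f x))[Is].
rewrite size_map => Is_iota ->; exists [seq nth x (x :: s) i | i <- Is].
  rewrite perm_sym; apply/(perm_iotaP x); by exists Is.
rewrite -map_comp; apply/eq_in_map => k kIs /=.
have : (k < size (x :: s))%N by rewrite -[(_ < _)%N](mem_iota 0) -(perm_mem Is_iota).
by move=> ?; rewrite -(nth_map x (f x)).
Qed.

(** Reordering [E] makes its list of types equal to that of [E']; the flattened lists then have the
    same blocks position by position and [avg_labels] applies. This reduces the comparison of two
    fillings to that of two multisets of types. *)
Lemma avg_types (phi : seq (H * H) -> R) E E' :
  (forall E1 E2, perm_eq E1 E2 -> phi E1 = phi E2) ->
  uniq (flat E) -> uniq (flat E') -> perm_eq (pmap b E) (pmap b E') ->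
  avg b (fun s => phi (pmap s E)) = avg b (fun s => phi (pmap s E')).
Proof.
move=> phiP uE uE' /perm_map_lift[E2 EE2 e].
have uE2 : uniq (flat E2) by rewrite -(perm_uniq (perm_flat EE2)).
transitivity (avg b (fun s => phi (pmap s E2))).
  by apply: eq_avg => s _; apply: phiP; exact: perm_map.
have lift E0 : avg b (fun s => phi (pmap s E0)) =
    avg b (fun s => phi (pairup (map s (flat E0)))).
  by apply: eq_avg => s _; rewrite -flat_pmap flatK.
rewrite !lift; apply: (@avg_labels _ _ _ b (fun s => phi (pairup s))) => //.
by rewrite -!flat_pmap; congr flat.
Qed.

End Types.

(** * The same-profile kernel *)

Section OneStep.
Variables (R : realFieldType) (H I : finType) (b : H -> I).
Variable Sg : {set {set H}}.
Hypothesis Sg0 : Sg != set0.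
Implicit Types (u E : seq (H * H)) (c n : I -> nat) (i j : I).

Definition mean_cut E : R := avg b (fun s => (max_cut Sg (pmap s E))%:R).

(** By [max_cut_cons], the probability that the pair of [x] and [y], added to [E], leaves the
    maximum cut unchanged. *)
Definition meet_prob E x y : R :=
  avg b (fun s => (profile Sg (pmap s E) (s x) == profile Sg (pmap s E) (s y))%:R).

Lemma mean_cut_types E E' : uniq (flat E) -> uniq (flat E') ->
  perm_eq (pmap b E) (pmap b E') -> mean_cut E = mean_cut E'.
Proof.
move=> uE uE' e; apply: (avg_types (phi := fun F => (max_cut Sg F)%:R)) => //.
by move=> F F' /max_cut_perm ->.
Qed.

Lemma mean_cut_cat E E' :
  mean_cut E <= mean_cut (E ++ E') <= mean_cut E + (size E')%:R.
Proof.
rewrite -[(size E')%:R](avg_const b) -avgD.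
by apply/andP; split; apply: le_avg => s _; rewrite -?natrD ler_nat /pmap map_cat;
  have := max_cut_cat Sg (pmap s E) (pmap s E'); rewrite size_map => /andP[].
Qed.

Lemma mean_cut_cons E x y : mean_cut ((x, y) :: E) = mean_cut E + 1 - meet_prob E x y.
Proof.
rewrite /mean_cut /meet_prob -[X in _ + X - _](avg_const b) -avgD -avgB; apply: eq_avg => s _.
rewrite -[pmap s (_ :: _)]/((s x, s y) :: pmap s E) max_cut_cons // natrD -addrA.
congr (_ + _) => /=.
by case: eqP; rewrite /= ?subrr ?subr0.
Qed.

(** For fixed [s] the quadratic form is the sum, over the possible profiles [C], of the square of
    the total weight of the half-edges with profile [C]. *)
Lemma meet_prob_psd E (a : H -> R) : 0 <= \sum_x \sum_y a x * a y * meet_prob E x y.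
Proof.
have -> : \sum_x \sum_y a x * a y * meet_prob E x y =
    avg b (fun s => \sum_(C : {set {set H}})
      (\sum_(x | profile Sg (pmap s E) (s x) == C) a x) ^+ 2).
  under eq_bigr do under eq_bigr do rewrite -avgZ.
  under eq_bigr do rewrite -avg_sum.
  rewrite -avg_sum; apply: eq_avg => s _.
  pose k x := profile Sg (pmap s E) (s x).
  under [RHS]eq_bigr do rewrite expr2 mulr_suml big_mkcond.
  rewrite [RHS]exchange_big; apply: eq_bigr => x _ /=.
  rewrite (bigD1 (k x)) //= eqxx [X in _ + X]big1 ?addr0 => [|C /negPf kC]; last first.
    by rewrite eq_sym kC.
  rewrite mulr_sumr [RHS]big_mkcond; apply: eq_bigr => y _ /=.
  by rewrite eq_sym /k; case: eqP => _; rewrite ?mulr1 ?mulr0.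
rewrite -[leLHS](avg_const b); apply: le_avg => s _.
by apply: sumr_ge0 => C _; exact: sqr_ge0.
Qed.

Lemma meet_prob_xx E x : meet_prob E x x = 1.
Proof. by rewrite -[RHS](avg_const b); apply: eq_avg => s _; rewrite eqxx. Qed.

Lemma meet_probC E x y : meet_prob E x y = meet_prob E y x.
Proof. by apply: eq_avg => s _; rewrite eq_sym. Qed.

Lemma uniq_cons_free E x y : uniq (flat E) ->
  x \notin flat E -> y \notin flat E -> x != y -> uniq (flat ((x, y) :: E)).
Proof. by move=> uE xE yE xy; rewrite /flat /= -/(flat E) !inE negb_or xy xE yE. Qed.

Lemma in_free E i z : (z \in free b E i) = (b z == i) && (z \notin flat E).
Proof. by rewrite !inE. Qed.

(** By [mean_cut_cons] this probability can be read off from the mean cut with the pair added, which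
    depends only on block types. *)
Lemma meet_prob_free E i j x y x' y' : uniq (flat E) ->
  x \in free b E i -> y \in free b E j -> x != y ->
  x' \in free b E i -> y' \in free b E j -> x' != y' ->
  meet_prob E x y = meet_prob E x' y'.
Proof.
rewrite !in_free => uE /andP[/eqP bx xE] /andP[/eqP By yE] xy.
move=> /andP[/eqP bx' xE'] /andP[/eqP By' yE'] xy'.
have : mean_cut ((x, y) :: E) = mean_cut ((x', y') :: E).
  apply: mean_cut_types; rewrite ?uniq_cons_free //=.
  by rewrite bx By bx' By'.
by rewrite !mean_cut_cons => /addrI /oppr_inj.
Qed.

Lemma sum_meet_prob_diag E i x y : uniq (flat E) ->
  x \in free b E i -> y \in free b E i -> x != y ->
  \sum_(x' in free b E i) \sum_(y' in free b E i) meet_prob E x' y' =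
    #|free b E i|%:R * (1 + (#|free b E i|%:R - 1) * meet_prob E x y).
Proof.
move=> uE xf yf xy; rewrite mulr_natl -sumr_const; apply: eq_bigr => x' x'f.
rewrite (bigD1 x') //= meet_prob_xx; congr (_ + _).
rewrite (eq_bigr (fun=> meet_prob E x y)) => [|y' /andP[y'f y'x]]; last first.
  by apply: (@meet_prob_free _ i i) => //; rewrite eq_sym.
rewrite sumr_const -[meet_prob E x y *+ _]mulr_natl; congr (_ * _).
rewrite (cardD1 x' (free b E i)) x'f natrD [X in _ = X - 1]addrC addrK.
congr (_%:R); apply: eq_card => z.
by rewrite [LHS]unfold_in !inE; case: (z == x'); rewrite ?andbF ?andbT.
Qed.

Lemma sum_meet_prob_off E i j x y : uniq (flat E) -> i != j ->
  x \in free b E i -> y \in free b E j ->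
  \sum_(x' in free b E i) \sum_(y' in free b E j) meet_prob E x' y' =
    #|free b E i|%:R * (#|free b E j|%:R * meet_prob E x y).
Proof.
move=> uE ij xf yf; rewrite mulr_natl -sumr_const; apply: eq_bigr => x' x'f.
rewrite mulr_natl -sumr_const; apply: eq_bigr => y' y'f.
have ne z t : z \in free b E i -> t \in free b E j -> z != t.
  rewrite !in_free => /andP[/eqP bz _] /andP[/eqP bt _].
  by apply: contraNneq ij => zt; rewrite -bz -bt zt.
by apply: (@meet_prob_free _ i j) => //; exact: ne.
Qed.

(* [meet_prob E] is positive semidefinite; evaluate it on the difference of the
   uniform distributions on the two sets of free half-edges.  The inverses come
   from the diagonal. *)
Lemma meet_prob_off_le E i j x1 x2 y1 y2 : uniq (flat E) -> i != j ->
  x1 \in free b E i -> x2 \in free b E i -> x1 != x2 ->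
  y1 \in free b E j -> y2 \in free b E j -> y1 != y2 ->
  2 * meet_prob E x1 y1 <= meet_prob E x1 x2 + #|free b E i|%:R^-1
                         + (meet_prob E y1 y2 + #|free b E j|%:R^-1).
Proof.
move=> uE ij x1f x2f x12 y1f y2f y12.
set v := #|free b E i|%:R : R; set w := #|free b E j|%:R : R.
have v0 : 0 < v by rewrite ltr0n; apply/card_gt0P; exists x1.
have w0 : 0 < w by rewrite ltr0n; apply/card_gt0P; exists y1.
pose A x : R := (x \in free b E i)%:R; pose B x : R := (x \in free b E j)%:R.
have sumAB (P Q : {set H}) : \sum_x \sum_y (x \in P)%:R * (y \in Q)%:R * meet_prob E x y
    = \sum_(x in P) \sum_(y in Q) meet_prob E x y :> R.
  rewrite [RHS]big_mkcond; apply: eq_bigr => x _.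
  case: (x \in P); last by rewrite big1 // => y _; rewrite !mul0r.
  rewrite [RHS]big_mkcond; apply: eq_bigr => y _.
  by case: (y \in Q); rewrite ?mul1r ?mul0r.
have := meet_prob_psd E (fun x => A x / v - B x / w).
have -> : \sum_x \sum_y (A x / v - B x / w) * (A y / v - B y / w) * meet_prob E x y
  = v^-1 ^+ 2 * (\sum_x \sum_y A x * A y * meet_prob E x y)
  - v^-1 * w^-1 * (\sum_x \sum_y A x * B y * meet_prob E x y)
  - v^-1 * w^-1 * (\sum_x \sum_y B x * A y * meet_prob E x y)
  + w^-1 ^+ 2 * (\sum_x \sum_y B x * B y * meet_prob E x y).
  rewrite !mulr_sumr -!sumrB -big_split; apply: eq_bigr => x _ /=.
  rewrite !mulr_sumr -!sumrB -big_split; apply: eq_bigr => y _ /=.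
  ring.
rewrite !sumAB (sum_meet_prob_diag uE x1f x2f x12) (sum_meet_prob_diag uE y1f y2f y12).
rewrite (sum_meet_prob_off uE ij x1f y1f).
have ji : j != i by rewrite eq_sym.
rewrite (sum_meet_prob_off uE ji y1f x1f) (meet_probC E y1 x1).
rewrite -/v -/w.
have m0 x y : 0 <= meet_prob E x y.
  by rewrite -[leLHS](avg_const b); apply: le_avg.
have -> : v^-1 ^+ 2 * (v * (1 + (v - 1) * meet_prob E x1 x2)) =
   v^-1 + meet_prob E x1 x2 - v^-1 * meet_prob E x1 x2.
  by field; rewrite gt_eqF.
have -> : w^-1 ^+ 2 * (w * (1 + (w - 1) * meet_prob E y1 y2)) =
   w^-1 + meet_prob E y1 y2 - w^-1 * meet_prob E y1 y2.
  by field; rewrite gt_eqF.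
have -> : v^-1 * w^-1 * (v * (w * meet_prob E x1 y1)) = meet_prob E x1 y1.
  by field; rewrite (gt_eqF v0) (gt_eqF w0).
have -> : v^-1 * w^-1 * (w * (v * meet_prob E x1 y1)) = meet_prob E x1 y1.
  by field; rewrite (gt_eqF v0) (gt_eqF w0).
have h1 : 0 <= v^-1 * meet_prob E x1 x2 by rewrite mulr_ge0 // invr_ge0 ltW.
have h2 : 0 <= w^-1 * meet_prob E y1 y2 by rewrite mulr_ge0 // invr_ge0 ltW.
lra.
Qed.

End OneStep.

(** * Trading one unrestricted pair for a pair inside a block *)

Section FillStep.
Variables (R : realFieldType) (H I : finType) (b : H -> I).
Variable Sg : {set {set H}}.
Hypothesis Sg0 : Sg != set0.
Implicit Types (u E : seq (H * H)) (c n : I -> nat) (i j : I).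
Local Notation mean_cut := (mean_cut R b Sg).
Local Notation free := (free b).
Local Notation fill := (fill b).

Definition bump c i : I -> nat := fun k => ((i == k) + c k)%N.

Lemma mean_cut_types_cat E E' (t : seq (I * I)) :
  uniq (flat E) -> uniq (flat E') -> perm_eq (pmap b E) (pmap b E' ++ t) ->
  mean_cut E' <= mean_cut E <= mean_cut E' + (size t)%:R.
Proof.
move=> uE uE' /perm_map_lift[E2 EE2 e].
have uE2 : uniq (flat E2) by rewrite -(perm_uniq (perm_flat EE2)).
have {}e : pmap b E2 = pmap b E' ++ t := e.
have -> : mean_cut E = mean_cut E2.
  by apply: mean_cut_types => //; exact: perm_map.
pose k := size E'.
have e1 : pmap b (take k E2) = pmap b E'.
  by rewrite /pmap map_take -/(pmap b E2) e take_size_cat // size_map.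
have e2 : size (drop k E2) = size t.
  have := congr1 size e; rewrite size_drop size_cat !size_map -/k => ->.
  by rewrite addKn.
have -> : mean_cut E' = mean_cut (take k E2).
  apply: mean_cut_types => //; last by rewrite e1.
  by move: uE2; rewrite -{1}(cat_take_drop k E2) flat_cat cat_uniq => /and3P[].
by rewrite -e2 -{2 3}(cat_take_drop k E2) mean_cut_cat.
Qed.

Lemma meet_prob01 E x y : 0 <= meet_prob R b Sg E x y <= 1.
Proof.
apply/andP; split; first by rewrite -[leLHS](avg_const b); apply: le_avg.
by rewrite -[leRHS](avg_const b); apply: le_avg => s _; case: eqP.
Qed.

(** Two half-edges are still free after filling, so block [i] has room for its extra pair, which has
    the type of [(x1, x2)]. *)
Lemma fill_bump u c i x1 x2 : uniq (flat u) ->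
  x1 \in free (fill u c) i -> x2 \in free (fill u c) i -> x1 != x2 ->
  mean_cut (fill u (bump c i)) = mean_cut ((x1, x2) :: fill u c).
Proof.
move=> uu x1f x2f x12.
have w2 : (1 < #|free (fill u c) i|)%N by apply/card_gt1P; exists x1, x2.
move: x1f x2f; rewrite !in_free => /andP[/eqP b1 x1E] /andP[/eqP b2 x2E].
apply: mean_cut_types; rewrite ?uniq_fill ?uniq_cons_free ?uniq_fill //.
rewrite /= b1 b2 !pmap_fill -cat1s perm_sym perm_catCA perm_cat2l perm_sym.
apply: perm_diag => k l; rewrite count_cat !count_mem_diag /= addn0 xpair_eqE /bump.
move: (card_free_fill b c i uu) w2.
have [->|ik] := eqVneq k i; last by rewrite /= !add0n ?addn0.
have [->|_] := eqVneq i l; rewrite /= ?mul1n ?mul0n //; lia.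
Qed.

Lemma fill_bump_full u c i : uniq (flat u) -> (#|free (fill u c) i| <= 1)%N ->
  mean_cut (fill u (bump c i)) = mean_cut (fill u c).
Proof.
move=> uu w1; apply: mean_cut_types; rewrite ?uniq_fill // !pmap_fill perm_cat2l.
apply: perm_diag => k l; rewrite !count_mem_diag /bump.
have := card_free_fill b c i uu.
have [->|ik] := eqVneq k i; last by rewrite add0n.
by move=> ?; congr (_ * _)%N; lia.
Qed.

Lemma fill_bump_le u c i : uniq (flat u) ->
  mean_cut (fill u (bump c i)) <= mean_cut (fill u c) + 1.
Proof.
move=> uu; have [w1|] := leqP #|free (fill u c) i| 1.
  by rewrite fill_bump_full // lerDl ler01.
move=> /card_gt1P[x1 [x2 [x1f x2f x12]]].
rewrite (fill_bump uu x1f x2f x12) mean_cut_cons //.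
have := meet_prob01 (fill u c) x1 x2; lra.
Qed.

Lemma card_free_cons u x y k : uniq (flat ((x, y) :: u)) ->
  (#|free ((x, y) :: u) k| + ((b x == k) + (b y == k)))%N = #|free u k|.
Proof.
move=> uu; have := card_free b k uu.
have uu' : uniq (flat u).
  by move: uu; rewrite -cat1s flat_cat cat_uniq => /and3P[].
have := card_free b k uu'; rewrite -cat1s /pmap map_cat flat_cat count_cat /=.
lia.
Qed.

(** The two half-edges left free in each block concerned let the pair of [x] and [y] enter without
    displacing any pair of the filling, even if both ends lie in one block. *)
Lemma fill_cons u c x y x1 y1 : uniq (flat ((x, y) :: u)) ->
  (1 < #|free (fill u c) (b x)|)%N -> (1 < #|free (fill u c) (b y)|)%N ->
  x1 \in free (fill u c) (b x) -> y1 \in free (fill u c) (b y) -> x1 != y1 ->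
  mean_cut (fill ((x, y) :: u) c) = mean_cut ((x1, y1) :: fill u c).
Proof.
move=> uu wx wy; rewrite !in_free => /andP[/eqP b1 x1E] /andP[/eqP b2 y1E] xy.
have uu' : uniq (flat u).
  by move: uu; rewrite -cat1s flat_cat cat_uniq => /and3P[].
apply: mean_cut_types; [exact: uniq_fill|by rewrite uniq_cons_free ?uniq_fill|].
rewrite -[X in perm_eq _ X]/((b x1, b y1) :: pmap b (fill u c)) b1 b2.
rewrite -[X in perm_eq X _]/((b x, b y) :: behead (pmap b (fill ((x, y) :: u) c))).
rewrite perm_cons !pmap_fill /= perm_cat2l.
apply: perm_diag => k l; rewrite !count_mem_diag; congr (_ * _)%N.
have := card_free_cons k uu.
have := card_free_fill b c (b x) uu'; have := card_free_fill b c (b y) uu'.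
move: wx wy; have [->|_] := eqVneq (b x) k; have [->|_] := eqVneq (b y) k; lia.
Qed.

(** Each end of the new pair displaces at most one pair of the filling, and each displaced pair is
    worth at most one. *)
Lemma fill_cons_ge u c x y : uniq (flat ((x, y) :: u)) ->
  mean_cut (fill u c) - 2 <= mean_cut (fill ((x, y) :: u) c).
Proof.
move=> uu; have uu' : uniq (flat u).
  by move: uu; rewrite -cat1s flat_cat cat_uniq => /and3P[].
have uF := uniq_fill b c uu.
rewrite -[fill ((x, y) :: u) c]/((x, y) :: behead (fill ((x, y) :: u) c)) in uF *.
set E := behead _ in uF *.
have uE : uniq (flat E).
  by move: uF; rewrite -cat1s flat_cat cat_uniq => /and3P[].
pose n k := minn (c k) #|free u k|./2.
pose n' k := minn (c k) #|free ((x, y) :: u) k|./2.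
have nn' k : (n k <= n' k + ((b x == k) + (b y == k)))%N.
  have := card_free_cons k uu; rewrite /n /n'; lia.
have n'n k : (n' k <= n k)%N.
  have := card_free_cons k uu; rewrite /n /n'; lia.
have /(mean_cut_types_cat (uniq_fill b c uu') uE)/andP[_ leE] :
    perm_eq (pmap b (fill u c)) (pmap b E ++ diag (fun k => n k - n' k)%N).
  have -> : pmap b E = behead (pmap b (fill ((x, y) :: u) c)) by [].
  rewrite !pmap_fill /= -catA perm_cat2l; apply: perm_diag => k l.
  by rewrite count_cat !count_mem_diag -mulnDr -/(n k) -/(n' k) subnKC.
have le2 : (size (diag (fun k => n k - n' k)) <= 2)%N.
  rewrite -(count_predT (diag _)) count_diag.
  apply: (@leq_trans (\sum_k ((b x == k) + (b y == k)))%N).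
    by apply: leq_sum => k _; rewrite mul1n leq_subLR.
  have sum1 i : (\sum_k (i == k) = 1)%N.
    by rewrite (bigD1 i) //= eqxx big1 // => k; rewrite eq_sym => /negPf->.
  by rewrite big_split /= !sum1.
have : mean_cut E <= mean_cut ((x, y) :: E).
  by rewrite mean_cut_cons //; have := meet_prob01 E x y; lra.
have : (size (diag (fun k => n k - n' k)%N))%:R <= 2 :> R by rewrite ler_nat.
lra.
Qed.

(* At least the inverse of the number of free half-edges if there are two of
   them, and at least [6], the cost of a step in which the block is full, if not. *)
Definition scarcity E i : R := 12 / (#|free E i|%:R + 1).

(** Within one block both sides agree by types. Across two blocks, positive semidefiniteness bounds
    the chance that the crossing pair is wasted by the mean of the chances for the two inner pairs,
    up to inverse free counts. *)
Lemma fill_step u c x y : uniq (flat ((x, y) :: u)) ->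
  mean_cut (fill u (bump c (b x))) - scarcity (fill u c) (b x)
  + (mean_cut (fill u (bump c (b y))) - scarcity (fill u c) (b y))
  <= 2 * mean_cut (fill ((x, y) :: u) c).
Proof.
move=> uu; have uu' : uniq (flat u).
  by move: uu; rewrite -cat1s flat_cat cat_uniq => /and3P[].
set i := b x; set j := b y; set E := fill u c.
have bad k : (#|free E k| <= 1)%N -> 6 <= scarcity E k.
  rewrite /scarcity -(ler_nat R) ler_pdivlMr ?ltr_wpDl //; lra.
have good k : (1 < #|free E k|)%N -> #|free E k|%:R^-1 <= scarcity E k.
  move=> w1; have : 1 < #|free E k|%:R :> R by rewrite ltr1n.
  rewrite /scarcity; set w := _%:R => w1R.
  rewrite ler_pdivlMr ?ltr_wpDl // ?(ltW (lt_trans _ w1R)) // ler_pdivrMl; lra.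
have e0 k : 0 <= scarcity E k by rewrite divr_ge0 // addr_ge0.
have := fill_cons_ge c uu; rewrite -/E.
have := fill_bump_le c i uu'; have := fill_bump_le c j uu'; rewrite -/E.
have := e0 i; have := e0 j.
(* If a block is full, the two bumped fillings gain at most 1 each, and inserting the pair loses at
   most 2, counted twice; the gap of 6 is paid by one scarcity term. *)
have [wi|wi] := leqP #|free E i| 1; first by have := bad i wi; lra.
have [wj|wj] := leqP #|free E j| 1; first by have := bad j wj; lra.
move=> ei ej _ _ _.
have /card_gt1P[x1 [x2 [x1f x2f x12]]] := wi.
have [ij|ij] := eqVneq i j.
  rewrite -ij (fill_bump uu' x1f x2f x12).
  rewrite (fill_cons uu wi wj x1f _ x12) -/j -?ij //; lra.
have /card_gt1P[y1 [y2 [y1f y2f y12]]] := wj.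
rewrite (fill_bump uu' x1f x2f x12) (fill_bump uu' y1f y2f y12).
have xy1 : x1 != y1.
  move: x1f y1f; rewrite !in_free => /andP[/eqP b1 _] /andP[/eqP b2 _].
  by apply: contraNneq ij => e; rewrite -b1 -b2 e.
rewrite (fill_cons uu wi wj x1f y1f xy1) !mean_cut_cons // -/E.
have := meet_prob_off_le R Sg0 (uniq_fill b c uu') ij x1f x2f x12 y1f y2f y12.
have := good i wi; have := good j wj; rewrite -/E; lra.
Qed.

End FillStep.

(** * Second moments for uniform permutations *)

Section UniformAverage.
Variables (R : realFieldType) (H I : finType) (b : H -> I).

(** A single block, preserved by every permutation: [avg_all] averages over the whole symmetric
    group. *)
Definition trivial_block (x : H) : unit := tt.

Definition avg_all (phi : {perm H} -> R) : R := avg trivial_block phi.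

Lemma trivial_block_perms (s : {perm H}) : s \in block_perms trivial_block.
Proof. by apply/block_permsP. Qed.

Lemma avg_all_labels (phi : seq H -> R) (s1 s2 : seq H) :
  uniq s1 -> uniq s2 -> size s1 = size s2 ->
  avg_all (fun s => phi (map s s1)) = avg_all (fun s => phi (map s s2)).
Proof.
move=> u1 u2 e; apply: avg_labels => //.
by elim: s1 s2 e {u1 u2} => [|x s1 IHs] [|y s2] //= [] /IHs ->.
Qed.

Definition centered i (s : {perm H}) (x : H) : R :=
  (b (s x) == i)%:R - #|block b i|%:R / #|H|%:R.

Lemma sum_centered i s : \sum_x centered i s x = 0.
Proof.
rewrite /centered sumrB sumr_const.
have <- : \sum_z (b z == i)%:R = \sum_x (b (s x) == i)%:R :> R.
  by rewrite (reindex_inj (@perm_inj _ s)).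
have [D0|D0] := eqVneq #|H| 0%N.
  by rewrite D0 mulr0n big1 ?subrr // => x _; have := fintype0 x D0.
rewrite -[_ / _ *+ _]mulr_natr divfK ?pnatr_eq0 //.
rewrite (eq_bigr (fun z => if z \in block b i then 1 else 0)).
  by rewrite -big_mkcond sumr_const subrr.
by move=> z _; rewrite inE; case: eqP.
Qed.

(** By exchangeability all half-edges have the same second moment, and the sum of the squares does
    not depend on [s]: with [p] the density of block [i], it is [1 - p] times the block size. *)
Lemma avg_sqr_centered i x :
  avg_all (fun s => centered i s x ^+ 2) <= #|block b i|%:R / #|H|%:R.
Proof.
have D0 : 0 < #|H|%:R :> R by rewrite ltr0n; apply/card_gt0P; exists x.
rewrite ler_pdivlMr // mulr_natr -sumr_const.
rewrite (eq_bigr (fun y => avg_all (fun s => centered i s y ^+ 2))) => [|y _]; last first.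
  by apply: (avg_all_labels (fun l => ((b (head x l) == i)%:R
    - #|block b i|%:R / #|H|%:R) ^+ 2) (s1 := [:: x]) (s2 := [:: y])).
rewrite /avg_all -avg_sum -[leRHS](avg_const trivial_block); apply: le_avg => s _.
rewrite (eq_bigl xpredT) //; set p : R := #|block b i|%:R / #|H|%:R.
have <- : \sum_z ((b z == i)%:R - p) ^+ 2 = \sum_x centered i s x ^+ 2.
  by rewrite (reindex_inj (@perm_inj _ s)).
have -> : \sum_z ((b z == i)%:R - p) ^+ 2 =
    \sum_z (if z \in block b i then 1 - 2 * p else 0) + \sum_(z : H) p ^+ 2.
  rewrite -big_split; apply: eq_bigr => z _; rewrite inE.
  by case: eqP => _ /=; ring.
have -> : \sum_(z : H) p ^+ 2 = p * (p * #|H|%:R).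
  by rewrite sumr_const -[p ^+ 2 *+ _]mulr_natr mulrA.
rewrite -big_mkcond sumr_const -[_ *+ #|block b i|]mulr_natr.
have : p * #|H|%:R = #|block b i|%:R by rewrite /p divfK ?gt_eqF.
have : 0 <= p by rewrite divr_ge0.
have : 0 <= #|block b i|%:R :> R by [].
move: (#|block b i|%:R : R) (#|H|%:R : R) => Di D Di0 p0 e.
rewrite e; nra.
Qed.

(** Sampling without replacement: the centered indicators sum to zero, so the nonnegative variance
    and the [#|H| - 1] equal covariances cancel. *)
Lemma avg_centered_neq_le0 i x y : x != y ->
  avg_all (fun s => centered i s x * centered i s y) <= 0.
Proof.
move=> xy.
have const x' y' : x' != y' ->
    avg_all (fun s => centered i s x' * centered i s y') =
    avg_all (fun s => centered i s x * centered i s y).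
  move=> xy'; pose phi l : R :=
    ((b (nth x l 0) == i)%:R - #|block b i|%:R / #|H|%:R) *
    ((b (nth x l 1) == i)%:R - #|block b i|%:R / #|H|%:R).
  by apply: (avg_all_labels phi (s1 := [:: x'; y']) (s2 := [:: x; y]));
    rewrite //= inE ?xy ?xy'.
have : \sum_z avg_all (fun s => centered i s x * centered i s z) = 0.
  rewrite /avg_all -avg_sum -[RHS](avg_const trivial_block); apply: eq_avg => s _.
  by rewrite -mulr_sumr sum_centered mulr0.
rewrite (bigD1 x) //= (eq_bigr (fun=> avg_all (fun s => centered i s x * centered i s y))).
  rewrite sumr_const -mulr_natr => e.
  have n0 : 0 < #|[pred z | z != x]|%:R :> R.
    by rewrite ltr0n; apply/card_gt0P; exists y; rewrite !inE eq_sym.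
  have v0 : 0 <= avg_all (fun s => centered i s x * centered i s x).
    by rewrite -[leLHS](avg_const trivial_block); apply: le_avg => s _; rewrite -expr2 sqr_ge0.
  rewrite -(pmulr_lle0 _ n0); move: e v0; set V := _ * _; lra.
by move=> z zx; rewrite const // eq_sym.
Qed.

(** The weights are nonnegative, so the covariance terms only decrease the second moment and the
    diagonal bounds it. *)
Lemma variance_le i (a : H -> R) : (forall x, 0 <= a x) ->
  avg_all (fun s => (\sum_x a x * centered i s x) ^+ 2) <=
  #|block b i|%:R / #|H|%:R * \sum_x a x ^+ 2.
Proof.
move=> a0; rewrite mulr_sumr.
have -> : avg_all (fun s => (\sum_x a x * centered i s x) ^+ 2) =
    \sum_x \sum_y a x * a y * avg_all (fun s => centered i s x * centered i s y).
  under [RHS]eq_bigr do under eq_bigr do rewrite -avgZ.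
  under [RHS]eq_bigr do rewrite -avg_sum.
  rewrite -avg_sum; apply: eq_avg => s _.
  rewrite expr2 mulr_suml; apply: eq_bigr => x _; rewrite mulr_sumr.
  by apply: eq_bigr => y _; ring.
apply: ler_sum => x _; rewrite (bigD1 x) //= -[leRHS]addr0; apply: lerD.
  rewrite mulrC -expr2; apply: ler_wpM2r; first exact: sqr_ge0.
  exact: avg_sqr_centered.
apply: sumr_le0 => y yx; apply: mulr_ge0_le0; first by rewrite mulr_ge0.
by apply: avg_centered_neq_le0; rewrite eq_sym.
Qed.

End UniformAverage.

(** * Interpolation *)

(** [D] is the size of a block, [w] its number of free half-edges and [Y] the deviation of its load.
    If [Y] is at most [D / (2 q)], then [w] is at least that large; otherwise the trivial bound
    [12 D] is below the term in [Y]. *)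
Lemma scarcity_real (R : realFieldType) (w D Y q : R) : 0 < D -> 0 <= w -> 1 <= q -> D / q - Y <= w ->
  D * (12 / (w + 1)) <= 24 * q + 48 * q ^+ 2 * Y ^+ 2 / D.
Proof.
move=> D0 w0 q1 le.
have q0 : 0 < q by lra.
have w1 : 0 < w + 1 by lra.
have [Yle|Ygt] := lerP Y (D / q / 2).
  have h : D <= 2 * q * w.
    have : D / q / 2 <= w by lra.
    by rewrite !ler_pdivrMr //; lra.
  have : 0 <= 48 * q ^+ 2 * Y ^+ 2 / D.
    by rewrite divr_ge0 ?(ltW D0) // -mulrA -exprMn mulr_ge0 // sqr_ge0.
  suff : D * (12 / (w + 1)) <= 24 * q by lra.
  by rewrite mulrA ler_pdivrMr //; nra.
have h : D <= 2 * q * Y by move: Ygt; rewrite !ltr_pdivrMr //; lra.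
apply: (@le_trans _ _ (12 * D)).
  rewrite mulrA ler_pdivrMr //; nra.
have : 12 * D <= 48 * q ^+ 2 * Y ^+ 2 / D.
  rewrite ler_pdivlMr //.
  have : D ^+ 2 <= (2 * q * Y) ^+ 2 by rewrite lerXn2r // nnegrE; lra.
  by rewrite !exprMn; lra.
lra.
Qed.

Section Interpolation.
Variables (R : realFieldType) (H I : finType) (b : H -> I).
Implicit Types (P E : seq (H * H)) (s t : {perm H}) (i : I).
Local Notation free := (free b).
Local Notation fill := (fill b).
Local Notation scarcity := (scarcity R b).
Local Notation centered := (centered R b).

Definition starts P s : I -> nat :=
  fun i => count_mem i (map b (map s (map fst P))).

(** The number of half-edges that [x] claims in its block: one if [P1] uses it, two if it heads a
    pair of [P2], since that pair is placed inside the block of its first half-edge. *)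
Definition load P1 P2 (x : H) : nat :=
  (count_mem x (flat P1) + 2 * count_mem x (map fst P2))%N.

Lemma count_sum (T : finType) (Q : pred T) (l : seq T) :
  count Q l = (\sum_x count_mem x l * Q x)%N.
Proof.
elim: l => [|y l IHl] /=; first by rewrite big1.
under eq_bigr do rewrite mulnDl; rewrite big_split -IHl /=; congr (_ + _)%N.
by rewrite (bigD1 y) //= eqxx mul1n big1 ?addn0 // => x; rewrite eq_sym => /negPf->.
Qed.

Lemma sum_load P1 P2 : (\sum_x load P1 P2 x = (size P1).*2 + (size P2).*2)%N.
Proof.
have e (l : seq H) : (\sum_x count_mem x l = size l)%N.
  by rewrite -(count_predT l) count_sum; apply: eq_bigr => x _; rewrite muln1.
by rewrite big_split -big_distrr /= !e size_flat size_map mul2n.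
Qed.

Lemma load_block P1 P2 s i :
  (\sum_x load P1 P2 x * (b (s x) == i) =
   count_mem i (flat (pmap b (pmap s P1))) + (starts P2 s i).*2)%N.
Proof.
under eq_bigr do rewrite mulnDl -mulnA.
rewrite big_split -big_distrr /= -!(count_sum (fun x => b (s x) == i)).
by rewrite /starts !flat_pmap !count_map mul2n.
Qed.

(** The inequality is strict only if [fill] truncates the demand of block [i]. *)
Lemma free_load P1 P2 s i : uniq (flat P1) ->
  (#|block b i| <= #|free (fill (pmap s P1) (starts P2 s)) i|
                   + \sum_x load P1 P2 x * (b (s x) == i))%N.
Proof.
move=> uP.
have uP' : uniq (flat (pmap s P1)).
  by rewrite flat_pmap map_inj_uniq //; exact: perm_inj.
rewrite load_block -(card_free b i uP') -(card_free_fill b (starts P2 s) i uP').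
lia.
Qed.

Lemma load_deviation P1 P2 s i :
  \sum_x (load P1 P2 x)%:R * centered i s x =
  (\sum_x load P1 P2 x * (b (s x) == i))%N%:R
  - ((size P1).*2 + (size P2).*2)%N%:R * (#|block b i|%:R / #|H|%:R) :> R.
Proof.
rewrite -(sum_load P1 P2) !natr_sum mulr_suml -sumrB.
by apply: eq_bigr => x _; rewrite mulrBr natrM.
Qed.

Variable q : nat.
Hypothesis q0 : (0 < q)%N.

Lemma avg_sqr_deviation_le P1 P2 i : uniq (flat P1 ++ map fst P2) ->
  (q * ((size P1).*2 + (size P2).*2) + #|H| <= q * #|H|)%N ->
  avg_all (fun s => (\sum_x (load P1 P2 x)%:R * centered i s x) ^+ 2)
  <= 2 * #|block b i|%:R.
Proof.
move=> uP leD.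
have [D0|] := eqVneq #|H| 0%N.
  rewrite -[leRHS](avg_const (@trivial_block H)); apply: le_avg => s _.
  by rewrite big1 ?expr0n ?mulr_ge0 // => x _; have := fintype0 x D0.
rewrite -lt0n -(ltr0n R); set D : R := #|H|%:R => D0R.
have a0 x : 0 <= (load P1 P2 x)%:R :> R by [].
have sum2 : \sum_x (load P1 P2 x)%:R ^+ 2 <= 2 * D.
  apply: (@le_trans _ _ (\sum_x 2 * (load P1 P2 x)%:R)).
    apply: ler_sum => x _; rewrite -natrX -natrM ler_nat /load.
    have := count_uniq_mem x uP; rewrite count_cat.
    by case: (x \in _) => e; set m := count_mem x (flat P1) in e *; nia.
  rewrite -mulr_sumr ler_pM2l // -natr_sum sum_load ler_nat.
  by rewrite -(leq_pmul2l q0); apply: leq_trans leD; rewrite leq_addr.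
apply: (le_trans (variance_le b i a0)); rewrite -/D.
have := ler_wpM2l (divr_ge0 (ler0n R #|block b i|) (ltW D0R)) sum2.
move=> /le_trans; apply; rewrite -mulrA [_^-1 * _]mulrC -!mulrA mulfV ?gt_eqF //; lra.
Qed.

Lemma avg_scarcity_le P1 P2 i : uniq (flat P1 ++ map fst P2) ->
  (q * ((size P1).*2 + (size P2).*2) + #|H| <= q * #|H|)%N ->
  #|block b i|%:R * avg_all (fun s => scarcity (fill (pmap s P1) (starts P2 s)) i)
  <= 120 * q%:R ^+ 2.
Proof.
move=> uP leD; have [->|] := eqVneq #|block b i| 0%N; first by rewrite mul0r mulr_ge0 // sqr_ge0.
rewrite -lt0n => Di0.
have D0 : (0 < #|H|)%N by apply: leq_trans Di0 (max_card _).
set Di : R := _%:R; pose D : R := #|H|%:R.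
have Di0R : 0 < Di by rewrite ltr0n.
have D0R : 0 < D by rewrite ltr0n.
have q1R : 1 <= q%:R :> R by rewrite ler1n.
pose Y s := \sum_x (load P1 P2 x)%:R * centered i s x.
rewrite /avg_all -avgZ.
apply: (@le_trans _ _ (avg_all (fun s => 24 * q%:R + 48 * q%:R ^+ 2 / Di * Y s ^+ 2))).
  apply: le_avg => s _; rewrite [48 * _ / _ * _]mulrAC.
  apply: scarcity_real => //.
  have : uniq (flat P1) by move: uP; rewrite cat_uniq => /and3P[].
  move=> /(free_load P2 s i); rewrite -(ler_nat R) natrD -/Di => le.
  rewrite /Y load_deviation -/D -/Di.
  suff : ((size P1).*2 + (size P2).*2)%:R * (Di / D) <= Di - Di / q%:R by lra.
  rewrite mulrA ler_pdivrMr //.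
  have -> : (Di - Di / q%:R) * D = Di * ((q%:R * D - D) / q%:R).
    by field; rewrite gt_eqF // ltr0n.
  rewrite mulrC ler_pM2l // ler_pdivlMr ?ltr0n //.
  by move: leD; rewrite -(ler_nat R) natrD !natrM -/D; lra.
(* The second moment of [Y] is at most [2 Di], so the total is at most [24 q + 96 q^2], hence at
   most [120 q^2]. *)
have := avg_sqr_deviation_le i uP leD.
rewrite /avg_all avgD avg_const avgZ -/Di; set V := avg _ _ => leV.
have : 48 * q%:R ^+ 2 / Di * V <= 96 * q%:R ^+ 2.
  rewrite mulrAC ler_pdivrMr //.
  have := ler_wpM2l (sqr_ge0 (q%:R : R)) leV; lra.
have : q%:R <= q%:R ^+ 2 :> R by rewrite expr2 ler_peMl.
lra.
Qed.

(** The transposition of [x] and [y] fixes every half-edge of [P] and [l]; translating the average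
    by it exchanges the roles of [x] and [y]. *)
Lemma avg_exchange (Psi : seq (H * H) -> seq H -> H -> R) P (l : seq H) x y :
  x \notin flat P ++ l -> y \notin flat P ++ l ->
  avg_all (fun s => Psi (pmap s P) (map s l) (s x)) =
  avg_all (fun s => Psi (pmap s P) (map s l) (s y)).
Proof.
rewrite !mem_cat !negb_or => /andP[xP xl] /andP[yP yl].
rewrite -[RHS](avg_mull _ (trivial_block_perms (tperm x y))).
apply: eq_avg => s _; rewrite permM tpermR.
have e (m : seq H) : x \notin m -> y \notin m -> map (tperm x y * s)%g m = map s m.
  move=> xm ym; apply/eq_in_map => z zm.
  by rewrite permM tpermD //; [apply: contraNneq xm|apply: contraNneq ym] => ->.
by rewrite -[X in _ = Psi X _ _]flatK flat_pmap !e // -flat_pmap flatK.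
Qed.

(* The chosen half-edge is uniform among the half-edges not used by [P1] and by
   the first components of [P2], and at least [#|H| / q] of them remain. *)
Lemma avg_scarcity_at_le P1 P2 a : uniq (flat P1 ++ map fst P2) ->
  a \notin flat P1 ++ map fst P2 ->
  (q * ((size P1).*2 + (size P2).*2) + #|H| <= q * #|H|)%N ->
  avg_all (fun s => scarcity (fill (pmap s P1) (starts P2 s)) (b (s a)))
  <= 120 * q%:R ^+ 3 * #|I|%:R / #|H|%:R.
Proof.
move=> uP aP leD.
have D0 : (0 < #|H|)%N by apply/card_gt0P; exists a.
pose F s x := scarcity (fill (pmap s P1) (starts P2 s)) (b (s x)).
have F0 s x : 0 <= F s x by rewrite divr_ge0 // addr_ge0.
rewrite -[avg_all _]/(avg_all (F^~ a)).
have eqF x : x \notin flat P1 ++ map fst P2 -> avg_all (F^~ x) = avg_all (F^~ a).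
  move=> xP; apply: (@avg_exchange (fun u l z =>
    scarcity (fill u (fun i => count_mem i (map b l))) (b z))) => //.
have sumF : \sum_x avg_all (F^~ x) <= #|I|%:R * (120 * q%:R ^+ 2).
  rewrite /avg_all -avg_sum.
  apply: (@le_trans _ _ (avg_all (fun s => \sum_i #|block b i|%:R *
      scarcity (fill (pmap s P1) (starts P2 s)) i))).
    apply: le_avg => s _; rewrite /F.
    have <- : \sum_z scarcity (fill (pmap s P1) (starts P2 s)) (b z) =
        \sum_x scarcity (fill (pmap s P1) (starts P2 s)) (b (s x)).
      by rewrite (reindex_inj (@perm_inj _ s)).
    rewrite (partition_big b xpredT) //=; apply: ler_sum => i _.
    rewrite (eq_bigr (fun=> scarcity (fill (pmap s P1) (starts P2 s)) i)) => [|z /eqP-> //].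
    rewrite (eq_bigl (mem (block b i))) => [|z]; last by rewrite /= inE.
    by rewrite sumr_const mulr_natl.
  rewrite /avg_all avg_sum mulr_natl -sumr_const; apply: ler_sum => i _.
  by rewrite avgZ; exact: avg_scarcity_le.
pose V := [set x | x \notin flat P1 ++ map fst P2].
have leV : (#|H| <= q * #|V|)%N.
  have -> : #|V| = (#|H| - size (flat P1 ++ map fst P2))%N.
    have -> : V = ~: [set x in flat P1 ++ map fst P2] by apply/setP => x; rewrite !inE.
    by rewrite cardsCs setCK cardsE (card_uniqP uP).
  by rewrite size_cat size_flat size_map; nia.
have le1 : #|V|%:R * avg_all (F^~ a) <= \sum_x avg_all (F^~ x).
  rewrite mulr_natl -sumr_const [leRHS](bigID (mem V)) /= -[leLHS]addr0; apply: lerD.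
    by apply: ler_sum => x; rewrite inE => /eqF ->.
  by apply: sumr_ge0 => x _; rewrite -[leLHS](avg_const (@trivial_block H)); apply: le_avg.
rewrite ler_pdivlMr ?ltr0n // mulrC.
have Fa0 : 0 <= avg_all (F^~ a).
  by rewrite -[leLHS](avg_const (@trivial_block H)); apply: le_avg.
apply: (@le_trans _ _ (q%:R * (#|V|%:R * avg_all (F^~ a)))).
  by rewrite mulrA -natrM ler_wpM2r // ler_nat.
have := ler_wpM2l (ler0n R q) (le_trans le1 sumF); lra.
Qed.

Lemma subseq_map_fst P : subseq (map fst P) (flat P).
Proof.
elim: P => // p l IHl.
have p1 : subseq [:: p.1] [:: p.1; p.2] by rewrite sub1seq inE eqxx.
exact: (cat_subseq p1 IHl).
Qed.

Variable Sg : {set {set H}}.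
Hypothesis Sg0 : Sg != set0.
Local Notation mean_cut := (mean_cut R b Sg).

(* The pairs of [P1] are uniform.  A pair of [P2] only contributes the block of
   its first half-edge, inside which an edge is then placed. *)
Definition hybrid P1 P2 : R :=
  avg_all (fun s => mean_cut (fill (pmap s P1) (starts P2 s))).

(** The half-edges [a] and [a'] are exchangeable, so an extra pair in the block of [a] gives the
    same mean as one in the block of [a']. Averaging both choices allows [fill_step] to be applied
    for every [s]. *)
Lemma hybrid_step P1 P2 a a' : uniq (flat ((a, a') :: P1) ++ flat P2) ->
  (q * ((size P1).*2 + (size P2).*2) + #|H| <= q * #|H|)%N ->
  hybrid P1 ((a, a') :: P2) - 120 * q%:R ^+ 3 * #|I|%:R / #|H|%:R
  <= hybrid ((a, a') :: P1) P2.
Proof.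
rewrite -cat1s flat_cat -catA cat_uniq => /and3P[ua nP uP] leD.
have sub : subseq (flat P1 ++ map fst P2) (flat P1 ++ flat P2).
  exact/cat_subseq/subseq_map_fst.
have uP' := subseq_uniq sub uP.
have xP x : x \in [:: a; a'] -> x \notin flat P1 ++ map fst P2.
  by move=> xa; apply: contra nP => /(mem_subseq sub) xP; apply/hasP; exists x.
have aP : a \notin flat P1 ++ map fst P2 by apply: xP; rewrite inE eqxx.
have aP' : a' \notin flat P1 ++ map fst P2 by apply: xP; rewrite !inE eqxx orbT.
pose W (u : seq (H * H)) (l : seq H) (z : H) := let c i := count_mem i (map b l) in
  mean_cut (fill u (fun i => count_mem i (b z :: map b l))) - scarcity (fill u c) (b z).
have := avg_exchange W aP aP'.
set A := avg_all _; set A' := avg_all _ => AA'.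
have eA : A = hybrid P1 ((a, a') :: P2) -
    avg_all (fun s => scarcity (fill (pmap s P1) (starts P2 s)) (b (s a))).
  by rewrite -avgB.
have : A + A' <= 2 * hybrid ((a, a') :: P1) P2.
  rewrite -avgD -avgZ; apply: le_avg => s _.
  have uPs : uniq (flat ((s a, s a') :: pmap s P1)).
    rewrite -[(s a, s a') :: _]/(pmap s ((a, a') :: P1)) flat_pmap.
    rewrite map_inj_uniq; last exact: perm_inj.
    rewrite -cat1s flat_cat cat_uniq ua /=.
    by move: uP nP; rewrite cat_uniq has_cat negb_or => /andP[-> _] /andP[-> _].
  exact: (fill_step R b Sg0 (starts P2 s) uPs).
have := avg_scarcity_at_le uP' aP leD.
lra.
Qed.

End Interpolation.

(** [n] is the number of pairs that fit in a block of size [D] and [c] the number assigned to it. If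
    [c > n], put [x = c - n] and [y = D / q']; then [2 x + y <= Y] and [8 x y <= (2 x + y)^2] bound
    the excess [x] by the quadratic term. *)
Lemma overflow_real (R : realFieldType) (n c : nat) (D Y q' : R) : 0 < q' -> 0 <= D ->
  n.*2%:R = D -> c.*2%:R - D + D / q' <= Y ->
  (D == 0 -> c = 0%N) ->
  (n - minn c n)%N%:R <= n%:R - c%:R + q' / (8 * D) * Y ^+ 2.
Proof.
move=> q'0 D0 nD le c0.
have [cn|nc] := leqP c n.
  by rewrite natrB // lerDl mulr_ge0 ?sqr_ge0 // divr_ge0 ?mulr_ge0 // ltW.
have Dgt : 0 < D.
  by rewrite lt0r D0 andbT; apply/negP => /c0 c00; move: nc; rewrite c00.
have : 0 < c%:R - n%:R :> R by rewrite subr_gt0 ltr_nat.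
move: nD le; rewrite -!muln2 !natrM subnn.
set x : R := c%:R - n%:R; set y := D / q' => nD le x0.
have y0 : 0 < y by rewrite divr_gt0.
have -> : q' / (8 * D) = (8 * y)^-1 by rewrite /y; field; rewrite !gt_eqF.
have : x <= (8 * y)^-1 * Y ^+ 2.
  rewrite ler_pdivlMl; last by lra.
  have {}le : 2 * x + y <= Y by move: le; rewrite /x -nD; lra.
  have : (2 * x + y) ^+ 2 <= Y ^+ 2 by rewrite lerXn2r // nnegrE; lra.
  have := sqr_ge0 (2 * x - y); nra.
by rewrite /x mulr0n; lra.
Qed.

(** * From pairings inside blocks to a uniform pairing *)

Section BlockInterpolation.
Variables (R : realFieldType) (H I : finType) (b : H -> I).
Variable Sg : {set {set H}}.
Variable q : nat.
Hypothesis q0 : (0 < q)%N.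
Implicit Types (P E : seq (H * H)) (s t : {perm H}) (i : I).
Local Notation mean_cut := (mean_cut R b Sg).
Local Notation hybrid := (hybrid R b Sg).

Lemma avgC (H1 H2 : finType) (I1 I2 : eqType) (b1 : H1 -> I1) (b2 : H2 -> I2)
    (phi : {perm H1} -> {perm H2} -> R) :
  avg b1 (fun u => avg b2 (phi u)) = avg b2 (fun v => avg b1 (phi^~ v)).
Proof. by rewrite /avg -!mulr_suml exchange_big /= mulrAC. Qed.

Lemma avg_all_mulr (phi : {perm H} -> R) t :
  avg_all (fun s => phi (s * t)%g) = avg_all phi.
Proof.
congr (_ / _); rewrite [RHS](reindex_inj (mulIg t)).
by apply: eq_bigl => s; rewrite !trivial_block_perms.
Qed.

(** Without block pairs the inner permutation [t] is absorbed by the uniform [s] through right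
    translation. *)
Lemma hybrid_nil P :
  hybrid P [::] = avg_all (fun s => (max_cut Sg (pmap s P))%:R).
Proof.
rewrite /hybrid /mean_cut /avg_all avgC -[RHS](avg_const b); apply: eq_avg => t _.
rewrite -[RHS](avg_all_mulr _ t); apply: eq_avg => s _; congr (max_cut _ _)%:R.
have -> : fill b (pmap s P) (starts b [::] s) = pmap s P.
  rewrite /fill (eq_map (g := fun=> [::])) => [|i]; last by rewrite take0.
  by elim: (enum I) => [|i r]; rewrite /= ?cats0.
by rewrite pmap_comp; apply: eq_map => p /=; rewrite !permM.
Qed.

Hypothesis Sg0 : Sg != set0.

(** The pairs move from the second list to the first one at a time, with a fraction [1 / q] of the
    half-edges kept unpaired throughout. *)
Lemma hybrid_chain P1 P2 : uniq (flat P1 ++ flat P2) ->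
  (q * (size P1 + size P2).*2 + #|H| <= q * #|H|)%N ->
  hybrid P1 P2 - (size P2)%:R * (120 * q%:R ^+ 3 * #|I|%:R / #|H|%:R)
  <= hybrid (catrev P2 P1) [::].
Proof.
elim: P2 P1 => [|[a a'] P2 IHP] P1 uP leD; first by rewrite mul0r subr0.
have uP' : uniq (flat ((a, a') :: P1) ++ flat P2).
  move: uP; rewrite -cat1s flat_cat -[(a, a') :: P1]cat1s flat_cat.
  by rewrite (perm_uniq (permEl (perm_catCA _ _ _))) catA.
have := IHP ((a, a') :: P1) uP'; rewrite /= addSn -addnS => /(_ leD).
have := hybrid_step R b q0 Sg0 uP'.
have leD' : (q * ((size P1).*2 + (size P2).*2) + #|H| <= q * #|H|)%N.
  by apply: leq_trans leD; rewrite leq_add2r leq_mul2l -doubleD leq_double /= leq_add2l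
     leqnSn orbT.
move=> /(_ leD'); rewrite -[(size P2).+1]addn1 natrD mulrDl mul1r; lra.
Qed.

Hypothesis even_blocks : forall i, ~~ odd #|block b i|.

(** The demand [#|block b i|] is at least what fits, so truncation pairs up each block as far as
    possible. *)
Definition block_pairing : seq (H * H) := fill b [::] (fun i => #|block b i|).

Lemma sum_card_block : (\sum_i #|block b i| = #|H|)%N.
Proof.
rewrite -sum1_card (partition_big b xpredT) //=; apply: eq_bigr => i _.
by rewrite -sum1_card; apply: eq_bigl => x; rewrite inE.
Qed.

Lemma sum_starts P s : (\sum_i starts b P s i = size P)%N.
Proof.
have := count_sum predT [seq b x | x <- map s (map fst P)].
rewrite count_predT !size_map => ->; apply: eq_bigr => i _.
by rewrite muln1.
Qed.

(** The number of pairs missing from the complete block pairing is [#|H| / 2 - size P] plus the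
    overflow of blocks assigned more pairs than fit. The overflow of block [i] is at most
    [q / (8 #|block b i|)] times a squared deviation of mean at most [2 #|block b i|], which gives
    [q / 4] per block. *)
Lemma hybrid_start P : uniq (flat P) ->
  (q * (size P).*2 + #|H| <= q * #|H|)%N ->
  mean_cut block_pairing - (#|H|%:R / 2 - (size P)%:R) - #|I|%:R * q%:R / 4
  <= hybrid [::] P.
Proof.
move=> uP leD.
have uP' : uniq (flat [::] ++ map fst P).
  by apply: subseq_uniq uP; exact: subseq_map_fst.
have leD' : (q * ((size (Nil (H * H))).*2 + (size P).*2) + #|H| <= q * #|H|)%N by [].
pose Y i s := \sum_x (load [::] P x)%:R * centered R b i s x.
have freeB i : free b [::] i = block b i by apply/setP => x; rewrite !inE andbT.
have key s : mean_cut block_pairing - (#|H|%:R / 2 - (size P)%:R)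
    - \sum_i q%:R / (8 * #|block b i|%:R) * Y i s ^+ 2
    <= mean_cut (fill b [::] (starts b P s)).
  pose c := starts b P s.
  pose n i := #|block b i|./2.
  have u0 : uniq (flat (Nil (H * H))) by [].
  have types : perm_eq (pmap b block_pairing)
      (pmap b (fill b [::] c) ++ diag (fun i => n i - minn (c i) (n i))%N).
    rewrite !pmap_fill /=; apply: perm_diag => k l.
    by rewrite count_cat !count_mem_diag -mulnDr freeB /n; congr (_ * _)%N; lia.
  have /andP[_] := mean_cut_types_cat R Sg (uniq_fill b _ u0) (uniq_fill b c u0) types.
  have -> : size (diag (fun i => n i - minn (c i) (n i))%N) =
      (\sum_i (n i - minn (c i) (n i)))%N.
    by rewrite -(count_predT (diag _)) count_diag; apply: eq_bigr => i _; rewrite mul1n.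
  have : (\sum_i (n i - minn (c i) (n i)))%N%:R <=
      \sum_i ((n i)%:R - (c i)%:R + q%:R / (8 * #|block b i|%:R) * Y i s ^+ 2) :> R.
    rewrite natr_sum; apply: ler_sum => i _.
    apply: overflow_real => //; first by rewrite ltr0n.
    - by rewrite /n even_halfK.
    - rewrite /Y load_deviation load_block /= add0n -/(c i).
      have [D0|] := eqVneq #|H| 0%N.
        have -> : #|block b i| = 0%N by apply/eqP; rewrite -leqn0 -D0 max_card.
        have -> : c i = 0%N.
          by rewrite /c /starts; case: (P) => [|p P'] //; have := fintype0 p.1 D0.
        by rewrite !mul0r mulr0 subr0 !addr0.
      rewrite -lt0n -(ltr0n R) => D0R; set D : R := #|H|%:R.
      set Di : R := #|block b i|%:R.
      suff : (size P).*2%:R * (Di / D) <= Di - Di / q%:R by rewrite double0 add0n; lra.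
      rewrite mulrA ler_pdivrMr //.
      have -> : (Di - Di / q%:R) * D = Di * ((q%:R * D - D) / q%:R).
        by field; rewrite gt_eqF // ltr0n.
      rewrite mulrC; apply: ler_wpM2l => //; rewrite ler_pdivlMr ?ltr0n //.
      by move: leD; rewrite -(ler_nat R) natrD !natrM -/D; lra.
    - rewrite pnatr_eq0 cards_eq0 => /eqP b0; apply/count_memPn/negP => /mapP[x _ bx].
      by have := in_set0 x; rewrite -b0 inE bx eqxx.
  rewrite big_split sumrB /= -!natr_sum sum_starts.
  have -> : (\sum_i n i)%N%:R = #|H|%:R / 2 :> R.
    rewrite -sum_card_block !natr_sum mulr_suml; apply: eq_bigr => i _.
    by rewrite -[in RHS](even_halfK (even_blocks i)) -/(n i) -muln2 natrM mulfK ?pnatr_eq0.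
  by lra.
rewrite /hybrid; apply: le_trans (le_avg _) => [|s _]; last exact: key.
rewrite /avg_all avgB avg_const lerD2l lerN2 avg_sum.
rewrite -mulrA mulr_natl -sumr_const; apply: ler_sum => i _; rewrite avgZ.
have := avg_sqr_deviation_le R b q0 i uP' leD'; rewrite -/(Y i) => leV.
have [b0|] := eqVneq #|block b i| 0%N.
  by rewrite b0 mulr0 invr0 mulr0 mul0r divr_ge0.
rewrite -lt0n -(ltr0n R); set Di : R := #|block b i|%:R => Di0.
rewrite mulrAC ler_pdivrMr ?mulr_gt0 //.
have := ler_wpM2l (ler0n R q) leV; rewrite /avg_all -/Di; lra.
Qed.

Lemma block_interpolation P : uniq (flat P) -> (size P).*2 = #|H| -> (0 < #|H|)%N ->
  mean_cut block_pairing <=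
  avg_all (fun s => (max_cut Sg (pmap s P))%:R)
  + #|H|%:R / (2 * q%:R) + 1 + 61 * q%:R ^+ 3 * #|I|%:R.
Proof.
move=> uP sP D0.
(* [T] is the largest number of pairs that leaves a fraction [1 / q] of the half-edges unpaired; the
   pairs of [P] beyond the first [T] can only raise the maximum. *)
pose T := (q.-1 * #|H| %/ (2 * q))%N.
have leT : (T * (2 * q) <= q.-1 * #|H|)%N by exact: leq_divM.
have gtT : (q.-1 * #|H| < T.+1 * (2 * q))%N by rewrite ltn_ceil // muln_gt0.
have eq1 : (q.-1 * #|H| + #|H| = q * #|H|)%N by rewrite addnC -mulSn prednK.
have leD : (q * T.*2 + #|H| <= q * #|H|)%N by rewrite -eq1 leq_add2r; lia.
have TP : (T <= size P)%N.
  by rewrite -leq_double sP -(leq_pmul2l q0); apply: leq_trans leD; rewrite leq_addr.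
have sT : size (take T P) = T by rewrite size_takel.
have uT : uniq (flat (take T P)) by rewrite flat_take take_uniq.
have := hybrid_start uT; rewrite sT => /(_ leD).
have := @hybrid_chain [::] (take T P) uT; rewrite sT => /(_ leD).
rewrite hybrid_nil => chain start.
have mono : avg_all (fun s => (max_cut Sg (pmap s (catrev (take T P) [::])))%:R) <=
    avg_all (fun s => (max_cut Sg (pmap s P))%:R) :> R.
  apply: le_avg => s _; rewrite ler_nat.
  rewrite (@max_cut_perm _ _ _ (pmap s (take T P))); last first.
    by apply: perm_map; rewrite -/(rev _) perm_rev.
  rewrite -{2}(cat_take_drop T P) /pmap map_cat.
  by have /andP[] := max_cut_cat Sg (pmap s (take T P)) (pmap s (drop T P)).
have D0R : 0 < #|H|%:R :> R by rewrite ltr0n.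
have q1R : 1 <= q%:R :> R by rewrite ler1n.
have loss : #|H|%:R / 2 - T%:R <= #|H|%:R / (2 * q%:R) + 1 :> R.
  have -> : #|H|%:R / (2 * q%:R) + 1 = (#|H|%:R + 2 * q%:R) / (2 * q%:R) :> R.
    by field; rewrite gt_eqF // ltr0n.
  rewrite ler_pdivlMr ?mulr_gt0 ?ltr0n //.
  have : (q * #|H|)%:R <= (T.+1 * (2 * q) + #|H|)%:R :> R.
    by rewrite ler_nat -eq1 leq_add2r ltnW.
  by rewrite natrD !natrM -[T.+1]addn1 natrD; lra.
(* The [T <= #|H| / 2] steps cost at most [60 q^3] per block; the overflow [q / 4] brings this to at
   most [61 q^3]. *)
have err : T%:R * (120 * q%:R ^+ 3 * #|I|%:R / #|H|%:R) <= 60 * q%:R ^+ 3 * #|I|%:R :> R.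
  rewrite mulrA ler_pdivrMr //.
  have : T%:R <= #|H|%:R / 2 :> R.
    by rewrite ler_pdivlMr // -natrM ler_nat -sP -muln2 leq_mul2r TP.
  have Z0 : 0 <= q%:R ^+ 3 * #|I|%:R :> R by rewrite mulr_ge0 // exprn_ge0.
  by move=> /(ler_wpM2l Z0); lra.
have : #|I|%:R * q%:R / 4 <= q%:R ^+ 3 * #|I|%:R :> R.
  have : q%:R <= q%:R ^+ 3 :> R by rewrite -[leLHS]expr1 ler_weXn2l.
  move=> /(ler_wpM2l (ler0n R #|I|)).
  have : 0 <= #|I|%:R * q%:R :> R by rewrite mulr_ge0.
  lra.
lra.
Qed.

End BlockInterpolation.

(** * The configuration model as an average over permutations *)

Section UniformMatching.
Variables (R : realFieldType) (H : finType).
Implicit Types (P E : seq (H * H)) (A : {set {set H}}).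

Definition full_pairing P : bool := uniq (flat P) && ((size P).*2 == #|H|).

Definition pair_sets P : seq {set H} := [seq [set p.1; p.2] | p <- P].

Definition matching_of P : {set {set H}} := [set e in pair_sets P].

Lemma mem_full_pairing P z : full_pairing P -> z \in flat P.
Proof.
move=> /andP[uP /eqP sP]; move: z; apply/subset_cardP => //.
  by rewrite (card_uniqP uP) size_flat sP.
exact: subset_predT.
Qed.

Lemma full_pairing_pmap (s : {perm H}) P : full_pairing P -> full_pairing (pmap s P).
Proof.
move=> /andP[uP sP]; rewrite /full_pairing flat_pmap map_inj_uniq; last exact: perm_inj.
by rewrite uP size_map.
Qed.

Lemma full_pairing_neq P p : full_pairing P -> p \in P -> p.1 != p.2.
Proof.
move=> /andP[uP _] /splitPr Pp; case: Pp uP => P1 P2.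
by rewrite flat_cat cat_uniq => /and3P[_ _] /=; rewrite !inE negb_or => /andP[/andP[]].
Qed.

(** At most [size P] two-element sets cover [#|H| = 2 size P] elements, so equality holds in the
    union bound: the sets are disjoint and none is repeated. *)
Lemma perfect_matching_of P : full_pairing P ->
  is_perfect_matching (matching_of P) /\ uniq (pair_sets P).
Proof.
move=> fP; have /andP[uP /eqP sP] := fP.
have card2 e : e \in matching_of P -> #|e| = 2.
  by rewrite inE => /mapP[p pP ->]; rewrite cards2 (full_pairing_neq fP pP).
have cov : cover (matching_of P) = [set: H].
  apply/setP => z; rewrite inE; apply/bigcupP.
  have /flattenP[_ /mapP[p pP ->]] := mem_full_pairing z fP.
  rewrite !inE => zp; exists [set p.1; p.2]; last by rewrite !inE.
  by rewrite inE; apply: map_f.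
have [] := leq_card_cover (matching_of P).
rewrite cov cardsT (eq_bigr (fun=> 2%N)) => [|e /card2 //].
rewrite sum_nat_const => le tri.
have cardM : #|matching_of P| = size (pair_sets P).
  by apply/eqP; rewrite eqn_leq {1}cardsE card_size size_map -leq_double sP -[X in (_ <= X)%N]muln2.
split; last first.
  by apply/card_uniqP; rewrite -cardM cardsE.
rewrite /is_perfect_matching /finset.partition cov eqxx -tri /=.
apply/andP; split; last by apply/forall_inP => e /card2 ->.
apply/andP; split.
  by rewrite cardM size_map muln2 sP.
by apply/negP => /card2; rewrite cards0.
Qed.

Lemma full_pairing_exists A : is_perfect_matching A ->
  exists2 P, full_pairing P & matching_of P = A.
Proof.
move=> /andP[pA /forall_inP A2].
pose P := pairup (flatten [seq enum (e : {set H}) | e : {set H} <- enum A]).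
have key (L : seq {set H}) : all (fun e : {set H} => #|e| == 2) L ->
    pair_sets (pairup (flatten [seq enum (e : {set H}) | e : {set H} <- L])) = L /\
    flat (pairup (flatten [seq enum (e : {set H}) | e : {set H} <- L])) =
      flatten [seq enum (e : {set H}) | e : {set H} <- L].
  elim: L => //= e L IHL /andP[e2 /IHL[IH1 IH2]].
  move: e2; rewrite cardE; case ee : (enum e) => [|x [|y [|]]] //= _.
  rewrite /flat /= -/(flat _) IH1 IH2; split=> //; congr (_ :: _).
  by apply/setP => z; rewrite -(mem_enum e) ee !inE.
have [|e1 e2] := key (enum A).
  by apply/allP => e; rewrite mem_enum; exact: A2.
exists P; last by apply/setP => e; rewrite inE /P e1 mem_enum.
have cov z : z \in flat P.
  rewrite e2; apply/flattenP; have : z \in cover A.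
    by case/and3P: pA => /eqP -> _ _; rewrite inE.
  by case/bigcupP => e eA ze; exists (enum e); rewrite ?mem_enum //;
    apply/mapP; exists e; rewrite ?mem_enum.
have sz : size (flat P) = #|H|.
  rewrite e2 size_flatten /shape -map_comp sumnE big_map big_enum /=.
  rewrite -cardsT (card_partition pA); apply: eq_bigr => e _.
  by rewrite -cardE.
rewrite /full_pairing -size_flat sz eqxx andbT; apply/card_uniqP.
by rewrite sz; apply: eq_card => z; rewrite cov.
Qed.

Definition act_matching (s : {perm H}) A : {set {set H}} := 
  [set s @: (e : {set H}) | e : {set H} in A].

Lemma act_matching_of (s : {perm H}) P :
  act_matching s (matching_of P) = matching_of (pmap s P).
Proof.
apply/setP => e; rewrite inE /pair_sets -map_comp; apply/imsetP/mapP => -[].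
  by move=> f; rewrite inE => /mapP[p pP ->] ->; exists p; rewrite //= imsetU !imset_set1.
move=> p pP ->; exists [set p.1; p.2]; first by rewrite inE; apply: map_f.
by rewrite imsetU !imset_set1.
Qed.

(** Each [s] permutes the perfect matchings, so acting by [s] and averaging leaves the sum
    unchanged. Any two full pairings differ by a relabelling, so the average of [Z] over the images
    of a matching is the same for all matchings. *)
Lemma avg_matching (Z : {set {set H}} -> R) P : full_pairing P ->
  \sum_(A | is_perfect_matching A) Z A =
  #|[set A | @is_perfect_matching H A]|%:R * avg_all (fun s => Z (matching_of (pmap s P))).
Proof.
move=> fP; have /andP[uP /eqP sP] := fP.
have eqavg A : is_perfect_matching A ->
    avg_all (fun s => Z (act_matching s A)) = avg_all (fun s => Z (matching_of (pmap s P))).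
  move=> /full_pairing_exists[P' /andP[uP' /eqP sP'] <-].
  have lift E : avg_all (fun s => Z (matching_of (pmap s E))) =
      avg_all (fun s => Z (matching_of (pairup (map s (flat E))))).
    by apply: eq_avg => s _; rewrite -flat_pmap flatK.
  transitivity (avg_all (fun s => Z (matching_of (pmap s P')))).
    by apply: eq_avg => s _; rewrite act_matching_of.
  rewrite !lift; apply: (avg_all_labels (fun l => Z (matching_of (pairup l)))) => //.
  by rewrite !size_flat sP sP'.
transitivity (\sum_(A | is_perfect_matching A) avg_all (fun s => Z (act_matching s A))).
  rewrite /avg_all -avg_sum -[LHS](avg_const (@trivial_block H)); apply: eq_avg => s _.
  have actP t A : is_perfect_matching A -> is_perfect_matching (act_matching t A).
    move=> /full_pairing_exists[P' fP' <-]; rewrite act_matching_of.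
    by have [] := perfect_matching_of (full_pairing_pmap t fP').
  have actK t : cancel (act_matching t) (act_matching t^-1).
    move=> A; rewrite /act_matching -imset_comp -[RHS]imset_id; apply: eq_imset => e /=.
    rewrite -imset_comp -[RHS]imset_id; apply: eq_imset => x /=.
    by rewrite permK.
  rewrite (reindex_inj (can_inj (actK s))) /=; apply: eq_bigl => A.
  apply/idP/idP; last exact: actP.
  by move=> /(actP s^-1)%g; rewrite actK.
rewrite (eq_bigr _ eqavg) sumr_const mulr_natl; congr (_ *+ _).
by apply: eq_card => A; rewrite inE.
Qed.

End UniformMatching.

(** * The configuration model in terms of pairings *)

Section ConfigurationAverage.
Variables (R : realType) (N d : nat).
Local Notation H := (half_edge N d).
Implicit Types (P : seq (H * H)) (S : {set 'I_N}).

Definition pull S : {set H} := [set h : H | h.1 \in S].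

Definition pull_family (F : {set {set 'I_N}}) : {set {set H}} := [set pull S | S in F].

Lemma crosses_pair (V : finType) (u v : V) (S : {set V}) :
  (#|[set u; v]| == 2) && (#|[set u; v] :&: S| == 1%N) = ((u \in S) != (v \in S)).
Proof.
have [->|uv] := eqVneq u v; first by rewrite setUid cards1 eqxx.
rewrite cards2 uv /= setIUl.
have I1 w : [set w] :&: S = if w \in S then [set w] else finset.set0.
  by case: ifP => wS; [apply/setIidPl; rewrite sub1set|
    apply/disjoint_setI0; rewrite disjoints1 wS].
rewrite !I1; case: ifP => uS; case: ifP => vS;
  by rewrite ?setUid ?setU0 ?set0U ?cards1 ?cards0 ?cards2 ?uv.
Qed.

(** No set is repeated in [pair_sets P], so counting its entries counts edges. A pair at a single
    vertex gives a loop, and its two half-edges lie on the same side of [pull S]. *)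
Lemma cut_size_config P (M : perfect_matching H) S :
  full_pairing P -> pairs M = matching_of P ->
  cut_size (config_graph M) S = count (crossing (pull S)) P.
Proof.
move=> fP MP; have [_ uP] := perfect_matching_of fP.
pose Q (e : {set H}) := (#|fst @: e| == 2) && (#|(fst @: e) :&: S| == 1%N).
transitivity (count Q (pair_sets P)).
  transitivity #|[set e in pairs M | Q e]|.
    rewrite /cut_size -[LHS](card_imset (f := fun e : {e | e \in pairs M} => val e) _ val_inj).
    apply: eq_card => e; rewrite inE.
    apply/imsetP/andP => [[e' + ->]|[eM Qe]].
      by rewrite inE => Qe'; split; [exact: (valP e')|].
    by exists (Sub e eM).
  rewrite -size_filter -(card_uniqP _) ?filter_uniq //.
  by apply: eq_card => e; rewrite !inE MP mem_filter andbC inE.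
rewrite count_map; apply: eq_count => p /=.
by rewrite /Q imsetU !imset_set1 crosses_pair /crossing !inE.
Qed.

Lemma config_mean_avg (X : multigraph 'I_N -> R) (F : seq (H * H) -> R) P :
  full_pairing P ->
  (forall M E, full_pairing E -> pairs M = matching_of E ->
     X (config_graph M) = F E) ->
  config_mean d X = avg_all (fun s => F (pmap s P)).
Proof.
move=> fP XF.
(* The default value 0 is never reached, since [Z] is evaluated only at perfect matchings. *)
pose Z (A : {set {set H}}) : R :=
  if insub A is Some M then X (config_graph (M : perfect_matching H)) else 0.
have := avg_matching Z fP.
rewrite (reindex_omap (val : perfect_matching H -> _) insub) /=; last first.
  by move=> A pA; rewrite insubT.
rewrite (eq_bigl xpredT) => [|M]; last by rewrite valK eqxx (valP M).
rewrite (eq_bigr (fun M => X (config_graph M))) => [|M _]; last by rewrite /Z valK.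
rewrite /config_mean => ->.
have -> : #|{: perfect_matching H}| = #|[set A | @is_perfect_matching H A]|.
  by rewrite card_sig cardsE.
rewrite mulrAC mulfV ?mul1r; last first.
  rewrite pnatr_eq0 -lt0n; apply/card_gt0P; exists (matching_of P).
  by rewrite inE; have [] := perfect_matching_of fP.
apply: eq_avg => s _; rewrite /Z.
have fPs := full_pairing_pmap s fP; have [pM _] := perfect_matching_of fPs.
by rewrite insubT; apply: XF.
Qed.

Lemma EMaxCut_avg P : full_pairing P ->
  EMaxCut R N d = avg_all (fun s => (max_cut (pull_family setT) (pmap s P))%:R).
Proof.
move=> fP; apply: (config_mean_avg (F := fun E => (max_cut (pull_family setT) E)%:R)) => //.
move=> M E fE ME; congr _%:R; apply/eqP; rewrite eqn_leq; apply/andP; split.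
  apply/bigmax_leqP => S _; rewrite (cut_size_config S fE ME).
  by apply: leq_max_cut; apply: imset_f; rewrite inE.
apply: max_cut_le => _ /imsetP[S _ ->]; rewrite -(cut_size_config S fE ME).
exact: (leq_bigmax S).
Qed.

Lemma EMaxBis_avg P : full_pairing P ->
  EMaxBis R N d = avg_all (fun s =>
    (max_cut (pull_family [set S : {set 'I_N} | #|S| == N./2]) (pmap s P))%:R).
Proof.
move=> fP; apply: (config_mean_avg (F := fun E =>
  (max_cut (pull_family [set S : {set 'I_N} | #|S| == N./2]) E)%:R)) => //.
move=> M E fE ME; congr _%:R; apply/eqP; rewrite eqn_leq; apply/andP; split.
  apply/bigmax_leqP => S; rewrite card_ord => S2; rewrite (cut_size_config S fE ME).
  by apply: leq_max_cut; apply: imset_f; rewrite inE.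
apply: max_cut_le => _ /imsetP[S S2 ->]; rewrite -(cut_size_config S fE ME).
by apply: (leq_bigmax_cond S); move: S2; rewrite inE card_ord.
Qed.

Lemma full_pairing_enum : ~~ odd (N * d) -> full_pairing (pairup (enum {: H})).
Proof.
move=> even; have cH : #|{: H}| = (N * d)%N by rewrite card_prod !card_ord.
have e : size (enum {: H}) = (N * d)%N by rewrite -cardE cH.
rewrite /full_pairing flat_pairup size_pairup e even_halfK // take_oversize ?e //.
by rewrite enum_uniq cH eqxx.
Qed.

End ConfigurationAverage.

(** * Cutting the vertices into blocks *)

(** Precomposing [t] with a permutation [s] of block [i], extended by the identity, does not change
    the average over [t]. After averaging over [s] as well, the map that [t] induces on the block is
    absorbed by [s]. *)
Lemma avg_block (R : realFieldType) (H H' I : finType) (b : H -> I) (i : I)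
    (emb : H' -> H) (proj : H -> H') (phi : seq (H' * H') -> R) (P : seq (H' * H')) :
  (forall x, b (emb x) = i) -> cancel emb proj ->
  (forall z, b z = i -> emb (proj z) = z) ->
  avg b (fun t => phi (pmap (fun x => proj (t (emb x))) P)) =
  avg_all (fun s => phi (pmap s P)).
Proof.
move=> b_emb embK projK.
pose ext (s : {perm H'}) z := if b z == i then emb (s (proj z)) else z.
have ext_inj s : injective (ext s).
  move=> y z; rewrite /ext; case: eqP => by_; case: eqP => bz //.
  - by move/(can_inj embK)/perm_inj => e; rewrite -(projK y) // e projK.
  - by move=> e; case: bz; rewrite -e b_emb.
  - by move=> e; case: by_; rewrite e b_emb.
have extP s : perm (@ext_inj s) \in block_perms b.
  by apply/block_permsP => z; rewrite permE /ext; case: eqP => // ->; rewrite b_emb.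
transitivity (avg_all (fun s => avg b (fun t =>
    phi (pmap (fun x => proj (t (emb x))) (pmap s P))))).
  rewrite /avg_all -[LHS](avg_const (@trivial_block H')); apply: eq_avg => s _.
  rewrite -(avg_mull _ (extP s)); apply: eq_avg => t _; congr phi.
  rewrite pmap_comp; apply: eq_map => p /=.
  by rewrite !permM !permE /ext !b_emb eqxx !embK.
rewrite /avg_all avgC -[RHS](avg_const b); apply: eq_avg => t /block_permsP tP.
have inj : injective (fun x => proj (t (emb x))).
  by move=> x y /(congr1 emb); rewrite !projK ?tP ?b_emb // => /perm_inj/(can_inj embK).
rewrite -[RHS](avg_all_mulr _ (perm inj)); apply: eq_avg => s _; congr phi.
by rewrite pmap_comp; apply: eq_map => p /=; rewrite !permM !permE.
Qed.

(* Each block is flipped so as to counteract the imbalance of the previous ones. *)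
Lemma balanced_flips (n m : nat) (f : nat -> nat) : (forall i, f i <= n)%N ->
  exists flip : nat -> bool,
    let X := (\sum_(i < m) (if flip i then n - f i else f i))%N in
    (m * n <= 2 * X + n)%N && (2 * X <= m * n + n)%N.
Proof.
move=> fn; elim: m => [|m [flip /andP[]]]; first by exists xpred0; rewrite big_ord0.
set X := (\sum_(i < m) _)%N => le1 le2.
pose last := if (2 * X < m * n)%N then (2 * f m < n)%N else (n < 2 * f m)%N.
exists (fun i => if i == m then last else flip i).
rewrite big_ord_recr /= eqxx (eq_bigr (fun i : 'I_m => if flip i then n - f i else f i)%N).
  rewrite -/X /last; have := fn m.
  by case: ifP; case: ifP; lia.
by move=> i _; rewrite ltn_eqF.
Qed.

Lemma subset_of_card (T : finType) (A : {set T}) k : (k <= #|A|)%N ->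
  exists2 B : {set T}, B \subset A & #|B| = k.
Proof.
move=> kA; exists [set x in take k (enum A)].
  by apply/subsetP => x; rewrite inE => /mem_take; rewrite mem_enum.
by rewrite cardsE (card_uniqP _) ?take_uniq ?enum_uniq // size_takel // -cardE.
Qed.

Lemma adjust_card (T : finType) (A : {set T}) k : (k <= #|T|)%N ->
  exists2 B : {set T}, #|B| = k &
    (#|[set x | (x \in A) != (x \in B)]| <= (k - #|A|) + (#|A| - k))%N.
Proof.
move=> kT; have [le|/ltnW le] := leqP k #|A|.
  have [B BA cB] := subset_of_card le; exists B => //.
  rewrite (_ : [set x | _] = A :\: B) ?cardsD; last first.
    by apply/setP => x; rewrite !inE; have := subsetP BA x; do 2!case: (x \in _) => //=; move=> ->.
  by rewrite (setIidPr BA) cB leq_addl.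
have le' : (#|T| - k <= #|~: A|)%N by rewrite cardsCs setCK leq_sub2l.
have [B BA cB] := subset_of_card le'; exists (~: B); first by rewrite cardsCs setCK cB subKn.
rewrite (_ : [set x | _] = ~: A :\: B) ?cardsD; last first.
  by apply/setP => x; rewrite !inE; have := subsetP BA x; rewrite inE;
     do 2!case: (x \in _) => //=; move=> ->.
rewrite (setIidPr BA) cB cardsCs setCK; lia.
Qed.

(** * Gluing optimal cuts of the blocks into a bisection *)

Section Blocks.
Variables (R : realType) (N n d : nat).
Hypothesis n0 : (0 < n)%N.
Local Notation H := (half_edge N d).
Local Notation H' := (half_edge n d).
Local Notation m := (N %/ n)%N.

(** A pair that crosses [A] but not [B] has an end over the symmetric difference, and each vertex
    carries [d] half-edges, each occurring at most once in [flat E]. *)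
Lemma cut_change (A B : {set 'I_N}) (E : seq (H * H)) : uniq (flat E) ->
  (count (crossing (pull d A)) E <=
   count (crossing (pull d B)) E + d * #|[set x | (x \in A) != (x \in B)]|)%N.
Proof.
move=> uE; set D := [set x | _].
have : (count (fun h : H => h.1 \in D) (flat E) <= d * #|D|)%N.
  rewrite -size_filter -(card_uniqP _) ?filter_uniq //.
  apply: (@leq_trans #|setX D [set: 'I_d]|); last by rewrite cardsX cardsT card_ord mulnC.
  by apply/subset_leq_card/subsetP => h; rewrite mem_filter !inE => /andP[-> _].
rewrite count_flat => le; apply: leq_trans (leq_add (leqnn _) le).
elim: E {uE le} => //= p E; rewrite /crossing !inE.
by do 4!case: (_ \in _); rewrite /=; lia.
Qed.

Lemma vertex_block_subproof (v : 'I_N) : (v %/ n < m.+1)%N.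
Proof. by rewrite ltnS leq_div2r // ltnW. Qed.

(** The blocks are [m] intervals of [n] consecutive vertices; the last index [m] receives the
    [N mod n] remaining vertices. *)
Definition half_edge_block (h : H) : 'I_m.+1 := Ordinal (vertex_block_subproof h.1).

Lemma embed_subproof (i : 'I_m) (v : 'I_n) : (i * n + v < N)%N.
Proof.
apply: leq_trans (leq_divM N n); apply: (@leq_trans (i.+1 * n)%N).
  by rewrite mulSn addnC ltn_add2r.
by rewrite leq_mul2r ltn_ord orbT.
Qed.

Definition embed (i : 'I_m) (h : H') : H := (Ordinal (embed_subproof i h.1), h.2).

Definition project (h : H) : H' := (Ordinal (ltn_pmod h.1 n0), h.2).

Lemma embedK i : cancel (embed i) project.
Proof.
move=> [v k]; congr (_, _); apply: val_inj => /=.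
by rewrite modnMDl modn_small.
Qed.

Lemma half_edge_block_embed i h : half_edge_block (embed i h) = widen_ord (leqnSn m) i.
Proof. by apply: val_inj => /=; rewrite divnMDl // (divn_small (ltn_ord h.1)) addn0. Qed.

Lemma projectK (i : 'I_m) (h : H) :
  half_edge_block h = widen_ord (leqnSn m) i -> embed i (project h) = h.
Proof.
case: h => v k /(congr1 val) /= e; congr (_, _); apply: val_inj => /=.
by rewrite -e -divn_eq.
Qed.

Lemma card_block_embed (i : 'I_m) :
  #|block half_edge_block (widen_ord (leqnSn m) i)| = (n * d)%N.
Proof.
have -> : block half_edge_block (widen_ord (leqnSn m) i) = [set embed i h | h : H'].
  apply/setP => h; rewrite inE; apply/eqP/imsetP => [e|[h' _ ->]].
    by exists (project h); rewrite // projectK.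
  exact: half_edge_block_embed.
by rewrite card_imset ?card_prod ?card_ord //; exact: can_inj (embedK i).
Qed.

Hypothesis even_n : ~~ odd n.
Hypothesis even_N : ~~ odd N.

(** The remainder block is even because the total [N d] and all other blocks are. *)
Lemma even_block i : ~~ odd #|block half_edge_block i|.
Proof.
have even_lt (j : 'I_m) : ~~ odd #|block half_edge_block (widen_ord (leqnSn m) j)|.
  by rewrite card_block_embed oddM (negPf even_n).
have := sum_card_block half_edge_block.
rewrite big_ord_recr /= card_prod !card_ord.
have [im|] := ltnP i m.
  by move=> _; rewrite (_ : i = widen_ord (leqnSn m) (Ordinal im)) //; apply: val_inj.
move=> mi; have -> : i = ord_max by apply: val_inj; apply/eqP; rewrite eqn_leq mi -ltnS ltn_ord.
move=> /(congr1 odd); rewrite oddD oddM (negPf even_N) /=.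
suff -> : odd (\sum_(j < m) #|block half_edge_block (widen_ord (leqnSn m) j)|) = false.
  by move=> /= ->.
by elim/big_ind: _ => // [x y|j _]; [rewrite oddD => -> -> | exact/negbTE/even_lt].
Qed.

Local Notation b := half_edge_block.

Definition block_pairs (i : 'I_m) : seq (H * H) :=
  pairup (rest b [::] (widen_ord (leqnSn m) i)).

Lemma mem_flat_block_pairs i h :
  h \in flat (block_pairs i) -> b h = widen_ord (leqnSn m) i.
Proof.
rewrite flat_pairup => /mem_take; rewrite mem_enum !inE andbT.
by move/eqP.
Qed.

Lemma embed_block_pairs i (t : {perm H}) : t \in block_perms b ->
  pmap (embed i) (pmap (fun x => project (t (embed i x))) (pmap project (block_pairs i)))
  = pmap t (block_pairs i).
Proof.
move=> /block_permsP tP; rewrite !pmap_comp.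
apply/eq_in_map => p /mem_flat/andP[/mem_flat_block_pairs b1 /mem_flat_block_pairs b2] /=.
by rewrite !projectK // ?tP // -?b1.
Qed.

Lemma full_pairing_block_pairs i : full_pairing (pmap project (block_pairs i)).
Proof.
rewrite /full_pairing size_map size_pairup -cardE.
have -> : free b [::] (widen_ord (leqnSn m) i) = block b (widen_ord (leqnSn m) i).
  by apply/setP => z; rewrite !inE andbT.
rewrite even_halfK ?even_block // card_block_embed card_prod !card_ord eqxx andbT.
rewrite flat_pmap map_inj_in_uniq.
  by rewrite flat_pairup take_uniq ?enum_uniq.
move=> x y /mem_flat_block_pairs bx /mem_flat_block_pairs By /(congr1 (embed i)).
by rewrite !projectK.
Qed.

(** Flipping a cut keeps its size, so the optimal cuts of the blocks can be flipped to make their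
    union nearly balanced. At most [n] vertices then change sides, at a cost of at most [d] pairs
    each. The contribution of the remainder block is bounded below by zero. *)
Lemma bisection_lower (t : {perm H}) : t \in block_perms b ->
  (\sum_(i < m) max_cut (pull_family d setT)
      (pmap (fun x => project (t (embed i x))) (pmap project (block_pairs i)))
   <= max_cut (pull_family d [set S : {set 'I_N} | #|S| == N./2])
        (pmap t (block_pairing b)) + d * n)%N.
Proof.
move=> tP; set E := pmap t _.
pose F i := pmap (fun x => project (t (embed i x))) (pmap project (block_pairs i)).
have attained (i : 'I_m) : exists S : {set 'I_n},
    count (crossing (pull d S)) (F i) = max_cut (pull_family d setT) (F i).
  have [|_ /imsetP[S _ ->] <-] := @max_cut_attained _ (pull_family d setT) _ (F i).
    by apply/set0Pn; exists (pull d set0); apply: imset_f; rewrite inE.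
  by exists S.
have [S Smax] := fin_all_exists attained.
pose f k := if insub k is Some i then #|S (i : 'I_m)| else 0%N.
have fi (i : 'I_m) : f i = #|S i| by rewrite /f valK.
have [flip] : exists flip : nat -> bool,
    let X := (\sum_(i < m) (if flip i then n - f i else f i))%N in
    (m * n <= 2 * X + n)%N && (2 * X <= m * n + n)%N.
  apply: balanced_flips => k; rewrite /f; case: insub => // i.
  by rewrite -[leqRHS]card_ord max_card.
pose T (i : 'I_m) := if flip i then ~: S i else S i.
have -> : (\sum_(i < m) (if flip i then n - f i else f i) = \sum_(i < m) #|T i|)%N.
  apply: eq_bigr => i _; rewrite /T fi; case: ifP => // _.
  by rewrite [RHS]cardsCs setCK card_ord.
have Tmax i : count (crossing (pull d (T i))) (F i) = max_cut (pull_family d setT) (F i).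
  rewrite -Smax /T; case: ifP => // _; apply: eq_count => p.
  by rewrite /crossing !inE; do 2!case: (_ \in _).
pose v (p : 'I_m * 'I_n) : 'I_N := Ordinal (embed_subproof p.1 p.2).
have v_inj : injective v.
  move=> [i x] [j y] /(congr1 val) /= e.
  have ij : i = j :> nat.
    have := congr1 (divn^~ n) e.
    by rewrite !divnMDl // !(divn_small (ltn_ord _)) !addn0.
  by congr (_, _); apply: val_inj => //=; move: e; rewrite ij => /addnI.
pose S0 := v @: [set p | p.2 \in T p.1].
have -> : (\sum_(i < m) #|T i| = #|S0|)%N.
  rewrite card_imset // -sum1_card.
  rewrite (eq_bigl (fun p : 'I_m * 'I_n => true && (p.2 \in T p.1))) => [|p]; last by rewrite inE.
  rewrite -(pair_big_dep xpredT (fun i x => x \in T i) (fun _ _ => 1%N)) /=.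
  by apply: eq_bigr => i _; rewrite sum1_card.
move=> /= /andP[le1 le2].
have S0_embed i h : (embed i h \in pull d S0) = (h \in pull d (T i)).
  by rewrite !inE /= -[Ordinal _]/(v (i, h.1)) mem_imset // inE.
have [B cB leB] : exists2 B : {set 'I_N}, #|B| = N./2 &
    (#|[set x | (x \in S0) != (x \in B)]| <= (N./2 - #|S0|) + (#|S0| - N./2))%N.
  by apply: adjust_card; rewrite card_ord; lia.
have uE : uniq (flat E).
  by rewrite flat_pmap map_inj_uniq ?uniq_fill //; exact: perm_inj.
have lowerS0 : (\sum_(i < m) max_cut (pull_family d setT) (F i) <=
    count (crossing (pull d S0)) E)%N.
  rewrite /E count_fill big_ord_recr /=; apply: leq_trans (leq_addr _ _).
  apply: leq_sum => i _; rewrite -Tmax take_oversize; last first.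
    rewrite size_pairup -cardE.
    apply: (@leq_trans #|free b [::] (widen_ord (leqnSn m) i)|).
      by rewrite -divn2 leq_div.
    by apply/subset_leq_card/subsetP => z; rewrite inE => /andP[].
  rewrite -(embed_block_pairs i tP) -/(F i) [X in (_ <= X)%N]count_map.
  by apply: eq_leq; apply: eq_count => p; rewrite /= /crossing /= !S0_embed.
apply: (leq_trans lowerS0); apply: (leq_trans (cut_change S0 B uE)).
apply: leq_add; first by apply: leq_max_cut; apply: imset_f; rewrite inE cB.
rewrite leq_mul2l; apply/orP; right; apply: (leq_trans leB).
(* The union differs from [m n / 2] by at most [n / 2], and [N - m n < n], so it is within [n] of
   [N / 2]. *)
move: (divn_eq N n) (ltn_pmod N n0) (even_halfK even_N) le1 le2.
by move: (m * n)%N (N %% n)%N #|S0| N./2 => a r X h; lia.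
Qed.

(** Each block is permuted uniformly, so the block cuts have total mean [m] times [EMaxCut R n d].
    [bisection_lower] turns them into a bisection for the pairing inside blocks, and
    [block_interpolation] passes to the uniform pairing. The factor [m.+1] includes the remainder
    block. *)
Lemma EMaxBis_lower q : (0 < q)%N -> (0 < N * d)%N ->
  m%:R * EMaxCut R n d - (d * n)%:R <=
  EMaxBis R N d + (N * d)%:R / (2 * q%:R) + 1 + 61 * q%:R ^+ 3 * m.+1%:R.
Proof.
move=> q0 Nd0.
have fP : full_pairing (pairup (enum {: H})).
  by apply: full_pairing_enum; rewrite oddM (negPf even_N).
have cH : #|{: H}| = (N * d)%N by rewrite card_prod !card_ord.
have Sg0 : pull_family d [set S : {set 'I_N} | #|S| == N./2] != set0.
  have [|B _ cB] := @subset_of_card _ [set: 'I_N] N./2.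
    by rewrite cardsT card_ord; lia.
  by apply/set0Pn; exists (pull d B); apply: imset_f; rewrite inE cB.
have /andP[uP /eqP sP] := fP.
have := block_interpolation R q0 Sg0 even_block uP sP.
rewrite -(EMaxBis_avg R fP) cH card_ord => /(_ Nd0).
apply: le_trans; rewrite lerBlDr.
have -> : m%:R * EMaxCut R n d = avg b (fun t => \sum_(i < m) (max_cut (pull_family d setT)
      (pmap (fun x => project (t (embed i x))) (pmap project (block_pairs i))))%:R).
  rewrite avg_sum mulr_natl -[X in _ *+ X]card_ord -sumr_const; apply: eq_bigr => i _.
  rewrite (EMaxCut_avg R (full_pairing_block_pairs i)); symmetry.
  apply: (avg_block (i := widen_ord (leqnSn m) i)
    (fun E => (max_cut (pull_family d setT) E)%:R)).
  - exact: half_edge_block_embed.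
  - exact: embedK.
  - exact: projectK.
rewrite -[X in _ + X](avg_const b) -avgD; apply: le_avg => t tP.
by rewrite -natr_sum -natrD ler_nat bisection_lower.
Qed.

End Blocks.

(** * Asymptotics *)

Section Asymptotics.
Variables (R : realType) (d : nat).
Hypothesis d0 : (0 < d)%N.

Lemma EMaxBis_ge0 n : 0 <= EMaxBis R n d.
Proof. by rewrite divr_ge0 // sumr_ge0. Qed.

Lemma EMaxBis_le_EMaxCut n : EMaxBis R n d <= EMaxCut R n d.
Proof.
apply: ler_wpM2r; first by rewrite invr_ge0.
apply: ler_sum => M _; rewrite ler_nat; apply/bigmax_leqP => S _.
exact: (leq_bigmax S).
Qed.

Lemma EMaxCut_le n : ~~ odd n -> EMaxCut R n d <= (n * d)%:R.
Proof.
move=> even_n; have fP : full_pairing (pairup (enum {: half_edge n d})).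
  by apply: full_pairing_enum; rewrite oddM (negPf even_n).
rewrite (EMaxCut_avg R fP) -[leRHS](avg_const (@trivial_block (half_edge n d))).
apply: le_avg => s _; rewrite ler_nat; apply: max_cut_le => cut _.
apply: leq_trans (count_size _ _) _; rewrite size_map size_pairup -cardE.
by rewrite card_prod !card_ord -divn2 leq_div.
Qed.

Lemma EMaxBis_asymptotic_lower (e : R) : 0 < e ->
  exists n0 : nat, forall n, (n0 <= n)%N -> ~~ odd n ->
  exists N0 : nat, forall N, (N0 <= N)%N -> ~~ odd N ->
    n%:R^-1 * EMaxCut R n d - e <= N%:R^-1 * EMaxBis R N d.
Proof.
move=> e0; have archi (z : R) : exists2 k : nat, (0 < k)%N & z <= k%:R.
  exists (Num.bound z).+1 => //; rewrite -natr1; have [z0|z0] := lerP 0 z.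
    by apply: le_trans (ltW (archi_boundP z0)) _; rewrite lerDl.
  by rewrite (le_trans (ltW z0)) // addr_ge0.
(* The unpaired half-edges, the errors of the blocks and the remaining terms each cost at most
   [e N / 4], by the choice of [q], then [n], then [N]. *)
have [q q0 qle] := archi (4 * d%:R / e).
have [n0 n00 n0le] := archi (4 * 61 * q%:R ^+ 3 / e).
exists n0 => n n0n even_n; have n1 : (0 < n)%N by apply: leq_trans n0n.
have [N0 N00 N0le] := archi (4 * (2 * (n%:R * d%:R) + 1 + 61 * q%:R ^+ 3) / e).
exists N0 => N N0N even_N; have N1 : (0 < N)%N by apply: leq_trans N0N.
have Nd0 : (0 < N * d)%N by rewrite muln_gt0 N1.
have := EMaxBis_lower R n1 even_n even_N q0 Nd0.
set a := EMaxCut R n d; set c := EMaxBis R N d; set m := (N %/ n)%N => lower.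
have n1R : 0 < n%:R :> R by rewrite ltr0n.
have N1R : 0 < N%:R :> R by rewrite ltr0n.
have q1R : 0 < q%:R :> R by rewrite ltr0n.
rewrite ler_pdivlMl //; set x := _^-1 * a.
have ax : a = n%:R * x by rewrite /x mulrA mulfV ?mul1r ?gt_eqF.
have x0 : 0 <= x.
  by rewrite mulr_ge0 ?invr_ge0 // (le_trans (EMaxBis_ge0 n) (EMaxBis_le_EMaxCut n)).
have xd : x <= d%:R by rewrite /x ler_pdivrMl // -natrM EMaxCut_le.
have mn : m%:R * n%:R <= N%:R :> R by rewrite -natrM ler_nat leq_divM.
have mn' : N%:R <= m%:R * n%:R + n%:R :> R.
  by rewrite -natrM -natrD ler_nat {1}(divn_eq N n) leq_add2l ltnW // ltn_pmod.
have nN : 4 * 61 * q%:R ^+ 3 <= n%:R * e.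
  by rewrite -ler_pdivrMr // (le_trans n0le) // ler_nat.
have NN : 4 * (2 * (n%:R * d%:R) + 1 + 61 * q%:R ^+ 3) <= N%:R * e.
  by rewrite -ler_pdivrMr // (le_trans N0le) // ler_nat.
have h1 : (N * d)%:R / (2 * q%:R) <= N%:R * e / 4.
  move: qle; rewrite ler_pdivrMr // ler_pdivrMr ?mulr_gt0 // natrM => qle.
  have := ler_wpM2l (ltW N1R) qle.
  have := mulr_ge0 (ltW N1R) (mulr_ge0 (ltW q1R) (ltW e0)); lra.
have h2 : 61 * q%:R ^+ 3 * m%:R <= N%:R * e / 4.
  have := ler_wpM2r (ler0n R m) nN; have := ler_wpM2l (ltW e0) mn; lra.
have h3 : N%:R * x <= m%:R * n%:R * x + n%:R * d%:R.
  have := ler_wpM2r x0 mn'; have := ler_wpM2l (ltW n1R) xd; lra.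
have Ne0 := mulr_gt0 N1R e0.
move: lower; rewrite ax [(d * n)%:R]natrM -[m.+1]addn1 natrD; lra.
Qed.

End Asymptotics.

From mathcomp Require Import all_classical all_reals all_analysis.
Import numFieldNormedType.Exports.

Local Open Scope classical_set_scope.

(** * Limits along even integers *)

Lemma near_even_infty (P : nat -> Prop) (N0 : nat) :
  (forall N, (N0 <= N)%N -> ~~ odd N -> P N) -> \forall N \near even_infty, P N.
Proof. by move=> h; exists N0 => // N /= N0N even_N; exact: h. Qed.

(* The common limit is the upper limit of [x]. *)
Lemma even_cvg_sandwich (R : realType) (x y : nat -> R) (B : R) :
  (forall n, ~~ odd n -> 0 <= x n <= B) -> (forall n, y n <= x n) ->
  (forall e, 0 < e -> exists n0 : nat, forall n, (n0 <= n)%N -> ~~ odd n ->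
     exists N0 : nat, forall N, (N0 <= N)%N -> ~~ odd N -> x n - e <= y N) ->
  exists b : R, x @ even_infty --> b /\ y @ even_infty --> b.
Proof.
move=> xB yx xy.
pose Z : set R := [set z | forall k : nat, exists2 n, (k <= n)%N & ~~ odd n /\ z <= x n].
have Z0 : Z 0.
  move=> k; have even_k : ~~ odd k.*2 by rewrite odd_double.
  by exists k.*2; [rewrite -addnn leq_addr | have /andP[] := xB _ even_k].
have supZ : has_sup Z.
  split; first by exists 0.
  exists B => z /(_ 0%N)[n _ [even_n zx]]; apply: le_trans zx _.
  by have /andP[] := xB n even_n.
(* Otherwise [x] exceeds [sup Z + e] at arbitrarily large even indices, and [sup Z + e] belongs to
   [Z]. *)
have upper e : 0 < e -> exists N0 : nat, forall N, (N0 <= N)%N -> ~~ odd N -> x N <= sup Z + e.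
  move=> e0; apply: contrapT => no.
  have : Z (sup Z + e).
    move=> k; apply: contrapT => none; apply: no; exists k => N kN even_N.
    rewrite leNgt; apply/negP => lt; apply: none; exists N => //; split=> //.
    exact: ltW.
  by move=> /(ub_le_sup supZ.2); lra.
(* Some [z] in [Z] is within [e / 2] of the supremum; a large even [n] with [z <= x n] then bounds
   [y N] below for all large even [N]. *)
have lower e : 0 < e -> exists N0 : nat, forall N, (N0 <= N)%N -> ~~ odd N -> sup Z - e <= y N.
  move=> e0; have e2 : 0 < e / 2 by lra.
  have [z Zz zlt] := sup_adherent e2 supZ.
  have [n0 hn0] := xy _ e2; have [n n0n [even_n zx]] := Zz n0.
  have [N0 hN0] := hn0 n n0n even_n; exists N0 => N N0N even_N.
  by have := hN0 N N0N even_N; lra.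
exists (sup Z); split; apply/cvgrPdist_le => e e0;
  have [N1 h1] := upper e e0; have [N2 h2] := lower e e0;
  apply: (@near_even_infty _ (maxn N1 N2)) => N; rewrite geq_max => /andP[N1N N2N] even_N;
  have := h1 N N1N even_N; have := h2 N N2N even_N; have := yx N;
  by rewrite ler_norml; lra.
Qed.

Theorem theorem5p4 (R : realType) (d : nat) (hd : (1 <= d)%N) :
  (fun n : nat => EMaxCut R n d - EMaxBis R n d)
    =o_even_infty (fun n : nat => n%:R : R) /\
  exists b : R,
    (n%:R^-1 * EMaxCut R n d @[n --> even_infty] --> b) /\
    (n%:R^-1 * EMaxBis R n d @[n --> even_infty] --> b).
Proof.
have [b [xb yb]] : exists b : R,
    (n%:R^-1 * EMaxCut R n d @[n --> even_infty] --> b) /\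
    (n%:R^-1 * EMaxBis R n d @[n --> even_infty] --> b).
  apply: (@even_cvg_sandwich _ _ _ d%:R).
  - move=> n even_n; rewrite mulr_ge0 ?invr_ge0 //=; last first.
      exact: le_trans (EMaxBis_ge0 R d n) (EMaxBis_le_EMaxCut R d n).
    have [->|n0] := eqVneq n 0%N; first by rewrite invr0 mul0r.
    by rewrite ler_pdivrMl ?ltr0n ?lt0n // -natrM EMaxCut_le.
  - by move=> n; rewrite ler_wpM2l ?invr_ge0 // EMaxBis_le_EMaxCut.
  - by move=> e e0; exact: EMaxBis_asymptotic_lower.
split; last by exists b.
apply/eqoP => e e0.
(* The two normalized sequences share the limit [b], so their difference tends to 0. *)
have : (n%:R^-1 * EMaxCut R n d - n%:R^-1 * EMaxBis R n d) @[n --> even_infty] --> b - b.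
  exact: cvgB.
rewrite subrr => /cvgrPdist_le /(_ e e0) [N0 _ h].
(* The successor makes [N] positive, so that the factor [N%:R^-1] can be cleared. *)
apply: (@near_even_infty _ N0.+1) => N N0N even_N.
have N0R : 0 < N%:R :> R by rewrite ltr0n (leq_trans _ N0N).
have := h N (ltnW N0N) even_N; rewrite /= sub0r normrN -mulrBr normrM normfV.
by rewrite ler_pdivrMl ?normr_gt0 ?gt_eqF // mulrC.
Qed.
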